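(* Let $X$ be an Archimedean lattice-ordered algebra with identity $1_X$, and let $\bm{x}=(x_1,\ldots,x_n)\in X^n$ for some $n\in\mathbb{N}$. The following are equivalent: (i) There is a lattice-algebra homomorphism $\Psi_{\bm{x}}\colon PG_n\to X$ with $\Psi_{\bm{x}}(\mathbf{1})=1_X$ and $\Psi_{\bm{x}}(\pi_i)=x_i$ for $i=1,\ldots,n$. (ii) Let $e=1_X\vee|x_1|\vee\cdots\vee|x_n|$. There exists an $f$-subalgebra $Y$ of $X$ such that $1_X,x_1,\ldots,x_n\in Y$ and, for every $m\in\mathbb{N}$, the norm $\|\cdot\|_{e^m}$ is complete on $Y\cap I_{e^m}$. (iii) There exist $f\in X$ with $f\ge 1_X\vee|x_1|\vee\cdots\vee|x_n|$ and an $f$-subalgebra $Y$ of $X$ such that $1_X,x_1,\ldots,x_n\in Y$ and, for every $m\in\mathbb{N}$, the norm $\|\cdot\|_{f^m}$ is complete on $Y\cap I_{f^m}$. When one, and hence all three, of these conditions are satisfied, the lattice-algebra homomorphism $\Psi_{\bm{x}}$ satisfying the conditions in (i) is unique.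
   Context: Here $\mathbb{N}=\{1,2,\ldots\}$. A lattice-ordered algebra is a real vector lattice that is also an associative real algebra in which the product of positive elements is positive. An $f$-algebra is a lattice-ordered algebra in which $x\wedge y=0$ and $z\ge 0$ imply $(zx)\wedge y=(xz)\wedge y=0$. A sublattice-algebra of a lattice-ordered algebra is a linear subspace that is both a vector sublattice and a subalgebra; an $f$-subalgebra is a sublattice-algebra that is itself an $f$-algebra. A lattice-algebra homomorphism is a linear map preserving lattice operations and products. For a vector lattice $X$ and $e\in X_+$, $I_e$ denotes the order ideal of $X$ generated by $e$, with norm $\|x\|_e=\inf\{\lambda\in[0,\infty):|x|\le\lambda e\}$. $PG_n$ denotes the lattice-ordered algebra (with pointwise operations) of continuous functions $f\colon\mathbb{R}^n\to\mathbb{R}$ of polynomial growth, i.e. for which there exist $N\in\mathbb{N}$ and $M\in[0,\infty)$ with $|f|\le M(\mathbf{1}+|\pi_1|+\cdots+|\pi_n|)^N$. Here $\mathbf{1}$ is the constant function one on $\mathbb{R}^n$ and $\pi_i\colon\mathbb{R}^n\to\mathbb{R}$ is the $i$-th coordinate projection. *)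

(* Defs.v *)
From HB Require Import structures.
From mathcomp Require Import all_boot all_order all_algebra.
From mathcomp Require Import all_classical all_reals all_analysis.
Import Order.TTheory GRing.Theory Num.Theory.
Import numFieldNormedType.Exports.

Set Implicit Arguments.
Unset Strict Implicit.
Unset Printing Implicit Defensive.

Local Open Scope classical_set_scope.
Local Open Scope ring_scope.

(* Real lattice-ordered algebras with identity; neither [0 <= 1] nor [1 != 0]
   is assumed. A record with raw operations is used because Hierarchy-Builder
   cannot declare a structure below both [latticeType] and [zmodType] once
   [Num.RealDomain] exists; the library instances are recovered on the carrier
   below. *)
Record loAlgType (R : realType) := LOAlg {
  lo_lmod : lmodType R;
  lo_le : rel lo_lmod;
  lo_meet : lo_lmod -> lo_lmod -> lo_lmod;
  lo_join : lo_lmod -> lo_lmod -> lo_lmod;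
  lo_one : lo_lmod;
  lo_mul : lo_lmod -> lo_lmod -> lo_lmod;
  lo_le_refl : reflexive lo_le;
  lo_le_anti : antisymmetric lo_le;
  lo_le_trans : transitive lo_le;
  lo_meetP : forall x y z, lo_le x (lo_meet y z) = lo_le x y && lo_le x z;
  lo_joinP : forall x y z, lo_le (lo_join x y) z = lo_le x z && lo_le y z;
  lo_leD2r : forall z x y, lo_le x y -> lo_le (x + z) (y + z);
  lo_scale_ge0 : forall (a : R) x, 0 <= a -> lo_le 0 x -> lo_le 0 (a *: x);
  lo_mulA : associative lo_mul;
  lo_mul1r : left_id lo_one lo_mul;
  lo_mulr1 : right_id lo_one lo_mul;
  lo_mulDl : left_distributive lo_mul +%R;
  lo_mulDr : right_distributive lo_mul +%R;
  lo_scaleAl : forall (a : R) x y, a *: lo_mul x y = lo_mul (a *: x) y;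
  lo_scaleAr : forall (a : R) x y, a *: lo_mul x y = lo_mul x (a *: y);
  lo_mul_ge0 : forall x y, lo_le 0 x -> lo_le 0 y -> lo_le 0 (lo_mul x y)
}.

Definition lo_sort (R : realType) (A : loAlgType R) : Type := lo_lmod A.
Coercion lo_sort : loAlgType >-> Sortclass.

Section LOAlgInstances.
Context {R : realType} (A : loAlgType R).

HB.instance Definition _ := GRing.Lmodule.copy (lo_sort A) (lo_lmod A).

HB.instance Definition _ := @Order.Le_isPOrder.Build ring_display (lo_sort A)
  (@lo_le R A) (@lo_le_refl R A) (@lo_le_anti R A) (@lo_le_trans R A).

HB.instance Definition _ :=
  @Order.POrder_MeetJoin_isLattice.Build ring_display (lo_sort A)
    (@lo_meet R A) (@lo_join R A) (@lo_meetP R A) (@lo_joinP R A).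

HB.instance Definition _ := @GRing.Zmodule_isPzRing.Build (lo_sort A)
  (lo_one A) (@lo_mul R A) (@lo_mulA R A) (@lo_mul1r R A) (@lo_mulr1 R A)
  (@lo_mulDl R A) (@lo_mulDr R A).

End LOAlgInstances.

Section OrderIdeals.
Context {R : realType} {X : loAlgType R}.
Implicit Types (e x y : X) (Y : set X).

Definition archimedean : Prop :=
  forall x y, 0 <= x -> (forall k : nat, x *+ k <= y) -> x = 0.

Definition vabs x : X := Order.join x (- x).

Definition order_ideal e : set X :=
  [set x | exists2 l : R, 0 <= l & vabs x <= l *: e].

(* A norm on [order_ideal e] only: outside it, [inf set0 = 0]. *)
Definition unit_norm e x : R := inf [set l : R | 0 <= l /\ vabs x <= l *: e].

(* Every Cauchy sequence of [Y] for [unit_norm e] converges in [Y]; to be used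
   with [Y] a linear subspace of [order_ideal e]. *)
Definition unit_norm_complete e Y : Prop :=
  forall u : nat -> X, (forall k, Y (u k)) ->
    (forall eps : R, 0 < eps -> exists K : nat, forall p q : nat,
        (K <= p)%N -> (K <= q)%N -> unit_norm e (u p - u q) < eps) ->
    exists2 l : X, Y l &
      forall eps : R, 0 < eps -> exists K : nat, forall p : nat,
        (K <= p)%N -> unit_norm e (u p - l) < eps.

End OrderIdeals.

Arguments archimedean {R} X.

Section SubAlgebras.
Context {R : realType} {X : loAlgType R}.
Implicit Types Y : set X.

Record sublattice_algebra Y : Prop := SublatticeAlgebra {
  sublat0 : Y 0;
  sublatD : forall x y, Y x -> Y y -> Y (x + y);
  sublatZ : forall (a : R) x, Y x -> Y (a *: x);
  sublat_meet : forall x y, Y x -> Y y -> Y (Order.meet x y);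
  sublat_join : forall x y, Y x -> Y y -> Y (Order.join x y);
  sublatM : forall x y, Y x -> Y y -> Y (x * y)
}.

(* The order and the lattice operations of a sublattice-algebra [Y] are those
   of [X], so the second conjunct says that [Y] itself is an f-algebra. *)
Definition f_subalgebra Y : Prop :=
  sublattice_algebra Y /\
  forall x y z, Y x -> Y y -> Y z -> Order.meet x y = 0 -> 0 <= z ->
    Order.meet (z * x) y = 0 /\ Order.meet (x * z) y = 0.

End SubAlgebras.

(* Preservation of the identities is not included. *)
Record lattice_algebra_hom (R : realType) (A B : loAlgType R) (f : A -> B) :
    Prop := LatticeAlgebraHom {
  lahom_linear : linear f;
  lahom_meet : {morph f : x y / Order.meet x y};
  lahom_join : {morph f : x y / Order.join x y};
  lahom_mul : {morph f : x y / x * y}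
}.

Section PolynomialGrowth.
Context {R : realType} {n : nat}.
Implicit Types f g : 'rV[R]_n -> R.

Definition polynomial_growth f : Prop :=
  exists N : nat, exists M : R, [/\ (0 < N)%N, 0 <= M &
    forall t, `|f t| <= M * (1 + \sum_(i < n) `|t ord0 i|) ^+ N].

Definition pg_pred : {pred 'rV[R]_n -> R^o} :=
  fun f : 'rV[R]_n -> R => `[< continuous f /\ polynomial_growth f >].

Let w (t : 'rV[R]_n) : R := 1 + \sum_(i < n) `|t ord0 i|.

Let w_ge1 t : 1 <= w t.
Proof. by rewrite lerDl sumr_ge0. Qed.

Let w_ge0 t : 0 <= w t.
Proof. exact: le_trans ler01 (w_ge1 t). Qed.

Lemma polynomial_growth_bound f g h : polynomial_growth f ->
  polynomial_growth g -> (forall t, `|h t| <= `|f t| + `|g t|) ->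
  polynomial_growth h.
Proof.
move=> [N1 [M1 [N10 M10 fM]]] [N2 [M2 [N20 M20 gM]]] hfg.
exists (N1 + N2)%N, (M1 + M2); split; first by rewrite addn_gt0 N10.
  exact: addr_ge0.
move=> t; apply: (le_trans (hfg t)); rewrite mulrDl; apply: lerD.
  apply: le_trans (fM t) _; apply: ler_wpM2l => //.
  by apply: ler_weXn2l; rewrite ?leq_addr//; exact: w_ge1.
apply: le_trans (gM t) _; apply: ler_wpM2l => //.
by apply: ler_weXn2l; rewrite ?leq_addl//; exact: w_ge1.
Qed.

Lemma polynomial_growth_mul f g : polynomial_growth f ->
  polynomial_growth g -> polynomial_growth (f \* g).
Proof.
move=> [N1 [M1 [N10 M10 fM]]] [N2 [M2 [N20 M20 gM]]].
exists (N1 + N2)%N, (M1 * M2); split; first by rewrite addn_gt0 N10.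
  exact: mulr_ge0.
by move=> t; rewrite normrM exprD mulrACA ler_pM.
Qed.

Lemma polynomial_growth_cst (c : R) : polynomial_growth (cst c).
Proof.
exists 1%N, `|c|; split => // t; rewrite expr1 ler_peMr//; exact: w_ge1.
Qed.

Lemma polynomial_growth_proj i : polynomial_growth (fun t => t ord0 i).
Proof.
exists 1%N, 1; split => // t; rewrite expr1 mul1r (bigD1 i)//= addrCA lerDl.
by rewrite addr_ge0// sumr_ge0.
Qed.

Lemma pg_subring_closed : subring_closed pg_pred.
Proof.
split.
- apply/asboolP; split; first by move=> t; exact: cst_continuous.
  exact: polynomial_growth_cst.
- move=> f g /asboolP[cf gf] /asboolP[cg gg]; apply/asboolP; split.
    by move=> t; apply: continuousB; [exact: cf|exact: cg].
  by apply: (polynomial_growth_bound gf gg) => t; exact: ler_normB.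
- move=> f g /asboolP[cf gf] /asboolP[cg gg]; apply/asboolP; split.
    by move=> t; apply: continuousM; [exact: cf|exact: cg].
  exact: polynomial_growth_mul.
Qed.

Lemma pg_subsemimod_closed :
  subsemimod_closed (pg_pred : {pred 'rV[R]_n -> R^o}).
Proof.
split.
  exact: GRing.zmod_closedD (GRing.subring_closedB pg_subring_closed).
move=> a f /asboolP[cf gf]; apply/asboolP; split.
  by move=> t; apply: continuousM; [exact: cst_continuous|exact: cf].
exact: (polynomial_growth_mul (polynomial_growth_cst a) gf).
Qed.

Lemma pg_min f g : f \in pg_pred -> g \in pg_pred ->
  (fun t => Order.meet (f t) (g t)) \in pg_pred.
Proof.
move=> /asboolP[cf gf] /asboolP[cg gg]; apply/asboolP.
have -> : (fun t => Order.meet (f t) (g t)) = f \min g.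
  by apply/funext => t; rewrite meetEtotal.
split; first by move=> t; apply: continuous_min; [exact: cf|exact: cg].
apply: (polynomial_growth_bound gf gg) => t /=.
by rewrite /Order.min; case: ifP => _; rewrite ?lerDl ?lerDr normr_ge0.
Qed.

Lemma pg_max f g : f \in pg_pred -> g \in pg_pred ->
  (fun t => Order.join (f t) (g t)) \in pg_pred.
Proof.
move=> /asboolP[cf gf] /asboolP[cg gg]; apply/asboolP.
have -> : (fun t => Order.join (f t) (g t)) = f \max g.
  by apply/funext => t; rewrite joinEtotal.
split; first by move=> t; apply: continuous_max; [exact: cf|exact: cg].
apply: (polynomial_growth_bound gf gg) => t /=.
by rewrite /Order.max; case: ifP => _; rewrite ?lerDl ?lerDr normr_ge0.
Qed.

Lemma pg_coord i : (fun t : 'rV[R]_n => t ord0 i) \in pg_pred.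
Proof.
apply/asboolP; split; first by move=> t; exact: coord_continuous.
exact: polynomial_growth_proj.
Qed.

End PolynomialGrowth.
Arguments pg_pred : clear implicits.

Section PG.
Variables (R : realType) (n : nat).

Record pgfun := PGFun {
  pgfun_val :> 'rV[R]_n -> R^o;
  pgfun_valP : pgfun_val \in pg_pred R n
}.

HB.instance Definition _ := [isSub for pgfun_val].
HB.instance Definition _ := [Choice of pgfun by <:].
HB.instance Definition _ :=
  GRing.SubChoice_isSubPzRing.Build _ _ pgfun (@pg_subring_closed R n).
HB.instance Definition _ :=
  GRing.SubZmodule_isSubLmodule.Build _ _ _ pgfun (@pg_subsemimod_closed R n).

Implicit Types f g h : pgfun.

Definition pg_le f g : bool := `[< forall t, f t <= g t >].
Definition pg_meet f g : pgfun := PGFun (pg_min (pgfun_valP f) (pgfun_valP g)).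
Definition pg_join f g : pgfun := PGFun (pg_max (pgfun_valP f) (pgfun_valP g)).

Lemma pg_ext f g : (forall t, f t = g t) -> f = g.
Proof. by move=> fg; apply/val_inj/funext. Qed.

Lemma pg_le_refl : reflexive pg_le.
Proof. by move=> f; apply/asboolP. Qed.

Lemma pg_le_anti : antisymmetric pg_le.
Proof.
move=> f g /andP[/asboolP fg /asboolP gf]; apply: pg_ext => t.
by apply/eqP; rewrite eq_le fg gf.
Qed.

Lemma pg_le_trans : transitive pg_le.
Proof.
move=> g f h /asboolP fg /asboolP gh; apply/asboolP => t.
exact: le_trans (fg t) (gh t).
Qed.

Lemma pg_meetP f g h : pg_le f (pg_meet g h) = pg_le f g && pg_le f h.
Proof.
apply/asboolP/andP => [H|[/asboolP fg /asboolP fh] t].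
  by split; apply/asboolP => t; have := H t; rewrite lexI => /andP[].
by rewrite lexI fg fh.
Qed.

Lemma pg_joinP f g h : pg_le (pg_join f g) h = pg_le f h && pg_le g h.
Proof.
apply/asboolP/andP => [H|[/asboolP fg /asboolP fh] t].
  by split; apply/asboolP => t; have := H t; rewrite leUx => /andP[].
by rewrite leUx fg fh.
Qed.

Lemma pg_leD2r h f g : pg_le f g -> pg_le (f + h) (g + h).
Proof. by move=> /asboolP fg; apply/asboolP => t; exact: lerD (fg t) _. Qed.

Lemma pg_scale_ge0 (a : R) f : 0 <= a -> pg_le 0 f -> pg_le 0 (a *: f).
Proof.
by move=> a0 /asboolP f0; apply/asboolP => t; exact: mulr_ge0 a0 (f0 t).
Qed.

Lemma pg_scaleAl (a : R) f g : a *: (f * g) = (a *: f) * g.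
Proof. by apply: pg_ext => t; exact: mulrA. Qed.

Lemma pg_scaleAr (a : R) f g : a *: (f * g) = f * (a *: g).
Proof. by apply: pg_ext => t; exact: mulrCA. Qed.

Lemma pg_mul_ge0 f g : pg_le 0 f -> pg_le 0 g -> pg_le 0 (f * g).
Proof.
move=> /asboolP f0 /asboolP g0; apply/asboolP => t.
exact: mulr_ge0 (f0 t) (g0 t).
Qed.

Definition PG : loAlgType R := @LOAlg R pgfun pg_le pg_meet pg_join 1 *%R
  pg_le_refl pg_le_anti pg_le_trans pg_meetP pg_joinP pg_leD2r pg_scale_ge0
  (@mulrA _) (@mul1r _) (@mulr1 _) (@mulrDl _) (@mulrDr _)
  pg_scaleAl pg_scaleAr pg_mul_ge0.

Definition pg_proj (i : 'I_n) : PG := PGFun (pg_coord i).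

Lemma PG_oneE t : ((1 : PG) : pgfun) t = 1. Proof. by []. Qed.
Lemma PG_addE (f g : PG) t :
  ((f + g : PG) : pgfun) t = (f : pgfun) t + (g : pgfun) t.
Proof. by []. Qed.
Lemma PG_scaleE a (f : PG) t : ((a *: f : PG) : pgfun) t = a * (f : pgfun) t.
Proof. by []. Qed.
Lemma PG_mulE (f g : PG) t :
  ((f * g : PG) : pgfun) t = (f : pgfun) t * (g : pgfun) t.
Proof. by []. Qed.
Lemma PG_meetE (f g : PG) t :
  ((Order.meet f g : PG) : pgfun) t = Num.min ((f : pgfun) t) ((g : pgfun) t).
Proof. exact: meetEtotal. Qed.
Lemma PG_joinE (f g : PG) t :
  ((Order.join f g : PG) : pgfun) t = Num.max ((f : pgfun) t) ((g : pgfun) t).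
Proof. exact: joinEtotal. Qed.
Lemma PG_projE i t : (pg_proj i : pgfun) t = t ord0 i.
Proof. by []. Qed.
Lemma PG_leP (f g : PG) :
  reflect (forall t, (f : pgfun) t <= (g : pgfun) t) (f <= g).
Proof. exact: asboolP. Qed.

End PG.
Arguments pg_proj {R n} i.

(* Main.v *)
Require Import Defs.
From HB Require Import structures.
From mathcomp Require Import all_boot all_order all_algebra.
From mathcomp Require Import all_classical all_reals all_analysis.
From mathcomp Require Import ring lra.
Import Order.TTheory GRing.Theory Num.Theory.
Import numFieldNormedType.Exports.

Set Implicit Arguments.
Unset Strict Implicit.
Unset Printing Implicit Defensive.

Local Open Scope classical_set_scope.
Local Open Scope ring_scope.

(** The implication from [cond_iii] to [cond_i] builds the calculus by
    localization. In an f-algebra with identity [1], every element [y] has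
    finite families of tents [(1 - |y - c| / delta)^+] whose sum is [1] up to a
    small multiple of [|y|]. Each tent confines [y] to within [delta] of the
    real number [c], because it is disjoint from [(|y - c| / delta - 1)^+] and
    disjointness survives multiplication ([tent_partition]). Such partitions
    give commutativity ([falg_mulC]), and their products confine a whole tuple
    [x] near points [v] of the n-space ([localized_partition]).

    Say that [y] represents a function [g] when, on every sharp localizer [psi]
    at a point [v], [y] is close to the constant [g v], with an error measured
    against a power of the weight [W = 1 + |x_1| + ... + |x_n|]. Representation
    respects linear combinations, joins and products, because all of these can
    be checked near one point at a time. Summing local errors over a fine
    partition of unity and using the Archimedean property shows that a function
    is represented by at most one element ([local_bound], [represents_inj]).
    The interpolants [sum_i g (v i) psi_i] represent [g] up to any prescribed
    error when [g] is continuous of polynomial growth, as [g] is then uniformly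
    continuous relative to a power of the weight ([weighted_modulus]); so
    completeness yields an element representing [g]. The map from [g] to that
    element is thus a homomorphism for free ([calculus_exists]). It is built
    inside the f-subalgebra, regarded as a lattice-ordered algebra of its own,
    and the norms of the powers of [f] enter only through the existence of
    limits: the sharper rates in terms of [W] come from the Archimedean property
    ([sharpen_limit_bound]).

    Uniqueness is the same interpolation carried out in the algebra of functions
    of polynomial growth: interpolants lie in the sublattice-algebra on which
    two calculi agree, and they approximate every function up to multiples of
    one power of the weight.

    For [cond_ii] from [cond_i], the subalgebra is the range of the calculus.
    Disjoint elements of the range have disjoint lifts, and a rapidly Cauchy
    sequence in the range lifts, after truncation, to a rapidly Cauchy sequence
    of functions, whose pointwise limit is again continuous and of polynomial
    growth ([range_complete]). *)

(** * Vector lattices and lattice-ordered algebras *)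

Section VectorLattice.
Context {R : realType} {X : loAlgType R}.
Implicit Types (x y z p q : X) (a b : R).

Lemma lo_leD2 z x y : x <= y -> x + z <= y + z.
Proof. exact: lo_leD2r. Qed.

Lemma lo_leD x y z t : x <= y -> z <= t -> x + z <= y + t :> X.
Proof.
move=> xy zt; apply: (le_trans (lo_leD2 z xy)).
by rewrite ![y + _]addrC; exact: lo_leD2.
Qed.

Lemma lo_leD2rE z x y : (x + z <= y + z) = (x <= y).
Proof.
apply/idP/idP => [xy|]; last exact: lo_leD2.
by have := lo_leD2 (- z) xy; rewrite !addrK.
Qed.

Lemma lo_subr_ge0 x y : (0 <= x - y) = (y <= x).
Proof. by rewrite -[LHS](lo_leD2rE y) add0r subrK. Qed.

Lemma lo_leBlDr x y z : (x - y <= z) = (x <= z + y).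
Proof. by rewrite -[LHS](lo_leD2rE y) subrK. Qed.

Lemma lo_leBrDr x y z : (x <= y - z) = (x + z <= y).
Proof. by rewrite -[LHS](lo_leD2rE z) subrK. Qed.

Lemma lo_leN2 x y : (- x <= - y) = (y <= x).
Proof. by rewrite -[LHS]lo_subr_ge0 opprK addrC lo_subr_ge0. Qed.

Lemma lo_lerNr x y : (x <= - y) = (y <= - x).
Proof. by rewrite -[RHS]lo_leN2 opprK. Qed.

Lemma lo_oppr_le0 x : (- x <= 0) = (0 <= x).
Proof. by rewrite -{1}oppr0 lo_leN2. Qed.

Lemma lo_addr_ge0 x y : 0 <= x -> 0 <= y -> 0 <= x + y.
Proof. by move=> x0 y0; rewrite -[0](addr0 (0 : X)); exact: lo_leD. Qed.

Lemma lo_sum_ge0 (I : Type) (s : seq I) (P : pred I) (F : I -> X) :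
  (forall i, P i -> 0 <= F i) -> 0 <= \sum_(i <- s | P i) F i.
Proof. by move=> F0; elim/big_ind: _ => //; exact: lo_addr_ge0. Qed.

Lemma lo_le_sum (I : Type) (s : seq I) (P : pred I) (F G : I -> X) :
  (forall i, P i -> F i <= G i) ->
  \sum_(i <- s | P i) F i <= \sum_(i <- s | P i) G i.
Proof. by move=> FG; elim/big_ind2: _ => // x1 x2 y1 y2; exact: lo_leD. Qed.

Lemma lo_scaler_ge0 a x : 0 <= a -> 0 <= x -> 0 <= a *: x.
Proof. exact: lo_scale_ge0. Qed.

Lemma lo_ler_wpZl a x y : 0 <= a -> x <= y -> a *: x <= a *: y.
Proof.
move=> a0 xy; rewrite -lo_subr_ge0 -scalerBr lo_scaler_ge0//.
by rewrite lo_subr_ge0.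
Qed.

Lemma lo_ler_wpZr a b x : a <= b -> 0 <= x -> a *: x <= b *: x.
Proof.
by move=> ab x0; rewrite -lo_subr_ge0 -scalerBl lo_scaler_ge0// subr_ge0.
Qed.

Lemma lo_mulr_ge0 x y : 0 <= x -> 0 <= y -> 0 <= x * y.
Proof. exact: lo_mul_ge0. Qed.

Lemma lo_ler_wpM2l x y z : 0 <= z -> x <= y -> z * x <= z * y.
Proof.
by move=> z0 xy; rewrite -lo_subr_ge0 -mulrBr lo_mulr_ge0// lo_subr_ge0.
Qed.

Lemma lo_ler_wpM2r x y z : 0 <= z -> x <= y -> x * z <= y * z.
Proof.
by move=> z0 xy; rewrite -lo_subr_ge0 -mulrBl lo_mulr_ge0// lo_subr_ge0.
Qed.

Lemma lo_mulZl a x y : (a *: x) * y = a *: (x * y) :> X.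
Proof. by symmetry; exact: lo_scaleAl. Qed.

Lemma lo_mulZr a x y : x * (a *: y) = a *: (x * y) :> X.
Proof. by symmetry; exact: lo_scaleAr. Qed.

Lemma lo_joinD z x y : Order.join x y + z = Order.join (x + z) (y + z).
Proof.
apply/le_anti/andP; split; last first.
  by rewrite leUx !lo_leD2rE leUl leUr.
by rewrite -lo_leBrDr leUx !lo_leBrDr leUl leUr.
Qed.

Lemma lo_oppr_join x y : - Order.join x y = Order.meet (- x) (- y).
Proof.
apply/le_anti/andP; split.
  by rewrite lexI !lo_leN2 leUl leUr.
by rewrite lo_lerNr leUx !(lo_lerNr _ (Order.meet _ _)) leIl leIr.
Qed.

Lemma lo_oppr_meet x y : - Order.meet x y = Order.join (- x) (- y).
Proof. by rewrite -[RHS]opprK lo_oppr_join !opprK. Qed.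

Lemma lo_meetD z x y : Order.meet x y + z = Order.meet (x + z) (y + z).
Proof.
by apply: oppr_inj; rewrite opprD !lo_oppr_meet lo_joinD !opprD.
Qed.

Lemma lo_join_meet x y : Order.join x y + Order.meet x y = x + y.
Proof.
apply/eqP; rewrite eq_sym -subr_eq; apply/eqP.
rewrite lo_oppr_meet addrC lo_joinD joinC.
by rewrite addKr addrCA addNr addr0.
Qed.

Lemma lo_meetE x y : Order.meet x y = x + y - Order.join x y.
Proof. by rewrite -(lo_join_meet x y) addrAC subrr add0r. Qed.

Lemma lo_joinZ a x y : 0 <= a ->
  a *: Order.join x y = Order.join (a *: x) (a *: y).
Proof.
rewrite le_eqVlt => /predU1P[<-|a0]; first by rewrite !scale0r joinxx.
apply/le_anti/andP; split; last first.
  by rewrite leUx !lo_ler_wpZl ?leUl ?leUr ?ltW.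
set t := Order.join (a *: x) _.
have aK (z : X) : a^-1 *: (a *: z) = z.
  by rewrite scalerA mulVf ?gt_eqF// scale1r.
rewrite -[t](@scale1r R) -[1](@divff _ a) ?gt_eqF// -scalerA.
apply: lo_ler_wpZl; first exact: ltW.
rewrite leUx -[X in (X <= _) && _]aK -[X in _ && (X <= _)]aK.
by rewrite !lo_ler_wpZl ?leUl ?leUr// invr_ge0 ltW.
Qed.

(** By [lo_join_meet], [x] is its meet with [z] plus the excess of its join with
    [z] over [z], and likewise for [y]; both excesses are at most that of the
    join of all three. *)
Lemma lo_meetUl x y z :
  Order.meet (Order.join x y) z = Order.join (Order.meet x z) (Order.meet y z).
Proof.
apply/le_anti/andP; split; last by rewrite leUx !leI2 ?leUl ?leUr.
set m := Order.join (Order.meet x z) _.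
rewrite [X in X <= _]lo_meetE lo_leBlDr -lo_leBrDr leUx; apply/andP; split.
  rewrite lo_leBrDr -(lo_join_meet x z) addrC; apply: lo_leD; first exact: leUl.
  by rewrite leU2// leUl.
rewrite lo_leBrDr -(lo_join_meet y z) addrC; apply: lo_leD; first exact: leUr.
by rewrite leU2// leUr.
Qed.

Lemma ler_vabs x : x <= vabs x. Proof. exact: leUl. Qed.
Lemma lerN_vabs x : - x <= vabs x. Proof. exact: leUr. Qed.

Lemma vabs_le x y : (vabs x <= y) = (x <= y) && (- x <= y).
Proof. exact: leUx. Qed.

Lemma vabsN x : vabs (- x) = vabs x.
Proof. by rewrite /vabs opprK joinC. Qed.

Lemma lo_double_ge0 x : 0 <= x + x -> 0 <= x.
Proof.
move=> h; rewrite (_ : x = 2^-1 *: (x + x)); first exact: lo_scaler_ge0.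
by rewrite scalerDr -scalerDl -[2^-1]div1r -splitr scale1r.
Qed.

Lemma vabs_ge0 x : 0 <= vabs x.
Proof.
apply: lo_double_ge0; rewrite -(subrr x).
by apply: lo_leD; [exact: ler_vabs|exact: lerN_vabs].
Qed.

Lemma vabs_ge0_id x : 0 <= x -> vabs x = x.
Proof.
move=> x0; apply/le_anti; rewrite ler_vabs vabs_le lexx/= andbT.
by rewrite (le_trans _ x0)// lo_oppr_le0.
Qed.

Lemma vabs0 : vabs (0 : X) = 0. Proof. exact: vabs_ge0_id. Qed.

Lemma vabs_le0 x : vabs x <= 0 -> x = 0.
Proof.
by rewrite vabs_le lo_oppr_le0 => xE; apply/le_anti.
Qed.

Lemma vabsD x y : vabs (x + y) <= vabs x + vabs y.
Proof. by rewrite vabs_le opprD !lo_leD ?ler_vabs ?lerN_vabs. Qed.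

Lemma vabsB x y : vabs (x - y) <= vabs x + vabs y.
Proof. by rewrite (le_trans (vabsD _ _))// vabsN. Qed.

Lemma vabs_subC x y : vabs (x - y) = vabs (y - x).
Proof. by rewrite -vabsN opprB. Qed.

Lemma vabs_dist x y z : vabs (x - z) <= vabs (x - y) + vabs (y - z).
Proof. by rewrite (le_trans _ (vabsD _ _))// addrA subrK. Qed.

Lemma vabs_sum (I : Type) (s : seq I) (P : pred I) (F : I -> X) :
  vabs (\sum_(i <- s | P i) F i) <= \sum_(i <- s | P i) vabs (F i).
Proof.
elim/big_rec2: _ => [|i y x _ h]; first by rewrite vabs0.
by rewrite (le_trans (vabsD _ _))// lo_leD.
Qed.

Lemma vabsZ a x : vabs (a *: x) = `|a| *: vabs x.
Proof.
wlog a0 : a / 0 <= a => [h|].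
  have [/h//|/ltW] := leP 0 a; rewrite -oppr_ge0 => /h.
  by rewrite scaleNr vabsN normrN.
by rewrite ger0_norm// /vabs -scalerN -lo_joinZ.
Qed.

(** Twice the difference of the two sides is the sum of the positive products
    [(vabs x - x) * (vabs y + y)] and [(vabs x + x) * (vabs y - y)]. *)
Lemma vabsM x y : vabs (x * y) <= vabs x * vabs y.
Proof.
have p0 z : 0 <= vabs z + z by rewrite -lo_leBlDr sub0r lerN_vabs.
have n0 z : 0 <= vabs z - z by rewrite lo_subr_ge0 ler_vabs.
have H z t : (vabs z - z) * (vabs t + t) + (vabs z + z) * (vabs t - t) =
   (vabs z * vabs t - z * t) + (vabs z * vabs t - z * t).
  rewrite mulrBl mulrDl !mulrDr !mulrN addrACA [RHS]addrACA; congr (_ + _).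
    by rewrite addrACA subrr addr0.
  by rewrite opprD addrACA addNr add0r.
rewrite vabs_le; apply/andP; split.
  rewrite -lo_subr_ge0; apply: lo_double_ge0; rewrite -H.
  by apply: lo_addr_ge0; apply: lo_mulr_ge0.
rewrite -lo_subr_ge0; apply: lo_double_ge0; have := H x (- y).
rewrite mulrN !vabsN => <-.
by apply: lo_addr_ge0; apply: lo_mulr_ge0 => //; rewrite opprK.
Qed.

(** Birkhoff's inequality. *)
Lemma vabs_join x y p q :
  vabs (Order.join x y - Order.join p q) <= vabs (x - p) + vabs (y - q).
Proof.
have H (u v s t : X) :
    Order.join u v - Order.join s t <= vabs (u - s) + vabs (v - t).
  rewrite lo_leBlDr leUx; apply/andP; split.
    rewrite -[X in X <= _](subrK s) lo_leD ?leUl// (le_trans (ler_vabs _))//.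
    by rewrite -[X in X <= _]addr0 lo_leD// vabs_ge0.
  rewrite -[X in X <= _](subrK t) lo_leD ?leUr// (le_trans (ler_vabs _))//.
  by rewrite -[X in X <= _]add0r lo_leD// vabs_ge0.
by rewrite vabs_le H opprB (vabs_subC x) (vabs_subC y) H.
Qed.

(** The form in which the Archimedean property enters below: error terms with
    an arbitrarily small factor can be dropped. All multiples of the positive
    part of [x - y] lie below [vabs z]. *)
Lemma archimedean_le (hX : archimedean X) x y z :
  (forall eps : R, 0 < eps -> x <= y + eps *: z) -> x <= y.
Proof.
move=> h; rewrite -(add0r y) -lo_leBlDr; set p := Order.join (x - y) 0.
have p0 : 0 <= p by exact: leUr.
suff /(hX _ (vabs z) p0) pz : forall k : nat, p *+ k <= vabs z.
  by rewrite -pz leUl.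
case=> [|k]; first by rewrite mulr0n vabs_ge0.
have k0 : (0 < k.+1%:R :> R) by rewrite ltr0n.
rewrite -scaler_nat.
suff pk : p <= k.+1%:R^-1 *: vabs z.
  have := lo_ler_wpZl (ltW k0) pk.
  by rewrite scalerA divff ?gt_eqF// scale1r.
have k1 : 0 <= k.+1%:R^-1 :> R by rewrite invr_ge0 ltW.
rewrite leUx (lo_scaler_ge0 k1 (vabs_ge0 z)) andbT.
rewrite lo_leBlDr addrC (le_trans (h k.+1%:R^-1 _)) ?invr_gt0//.
by rewrite lo_leD// lo_ler_wpZl ?ler_vabs.
Qed.

Lemma archimedean_eq (hX : archimedean X) x y z :
  (forall eps : R, 0 < eps -> vabs (x - y) <= eps *: z) -> x = y.
Proof.
move=> h; apply/eqP; rewrite -subr_eq0; apply/eqP/vabs_le0.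
by apply: (archimedean_le hX (z := z)) => eps /h; rewrite add0r.
Qed.

End VectorLattice.

(** * Tents and partitions of unity in f-algebras *)

Section PositivePart.
Context {R : realType} {X : loAlgType R}.
Implicit Types x y : X.

Definition pos_part x : X := Order.join x 0.

Lemma pos_part_ge0 x : 0 <= pos_part x. Proof. exact: leUr. Qed.

Lemma pos_part_id x : 0 <= x -> pos_part x = x.
Proof. by move=> x0; apply/join_idPl. Qed.

Lemma pos_partB x : pos_part x - pos_part (- x) = x.
Proof.
by rewrite {2}/pos_part lo_oppr_join opprK oppr0 lo_join_meet addr0.
Qed.

Lemma pos_part_disjoint x : Order.meet (pos_part x) (pos_part (- x)) = 0.
Proof.
have -> : pos_part x = x + pos_part (- x) by rewrite -{2}(pos_partB x) subrK.
rewrite -[X in Order.meet _ X]add0r -lo_meetD.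
by rewrite -[Order.meet _ _]opprK lo_oppr_meet oppr0 addNr.
Qed.

End PositivePart.

Section SublatticeAlgebra.
Context {R : realType} {X : loAlgType R} (Y : set X).
Hypothesis hY : sublattice_algebra Y.

Lemma sublatN x : Y x -> Y (- x).
Proof. by move=> Yx; rewrite -scaleN1r; exact: sublatZ. Qed.

Lemma sublatB x y : Y x -> Y y -> Y (x - y).
Proof. by move=> Yx Yy; apply: (sublatD hY) => //; exact: sublatN. Qed.

Lemma sublat_vabs x : Y x -> Y (vabs x).
Proof. by move=> Yx; apply: (sublat_join hY) => //; exact: sublatN. Qed.

Lemma sublat_pos_part x : Y x -> Y (pos_part x).
Proof. by move=> Yx; apply: (sublat_join hY) => //; exact: sublat0. Qed.

Lemma sublat_sum (I : Type) (s : seq I) (P : pred I) (F : I -> X) :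
  (forall i, Y (F i)) -> Y (\sum_(i <- s | P i) F i).
Proof.
by move=> YF; elim/big_ind: _ => //; [exact: sublat0|exact: sublatD].
Qed.

End SublatticeAlgebra.

Definition falg (R : realType) (X : loAlgType R) : Prop :=
  forall x y z : X, Order.meet x y = 0 -> 0 <= z ->
    Order.meet (z * x) y = 0 /\ Order.meet (x * z) y = 0.

Section FAlgebra.
Context {R : realType} {X : loAlgType R} (fX : falg X).
Implicit Types x y z a : X.

Lemma falg_disjoint_mul x y : Order.meet x y = 0 -> x * y = 0.
Proof.
move=> xy.
have x0 : 0 <= x by rewrite -xy leIl.
have y0 : 0 <= y by rewrite -xy leIr.
have [_ xyy] := fX xy y0.
have [+ _] := fX (etrans (meetC _ _) xyy) x0.
by rewrite meetxx.
Qed.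

Lemma falg_disjoint_mul3 x y z : Order.meet x y = 0 -> 0 <= z -> x * z * y = 0.
Proof. by move=> xy z0; apply: falg_disjoint_mul; exact: (fX xy z0).2. Qed.

(** The identity is its own square, and squares are positive because the
    cross terms of [x = pos_part x - pos_part (- x)] vanish. *)
Lemma falg_ge01 : 0 <= 1 :> X.
Proof.
have sq x : 0 <= x * x.
  rewrite -(pos_partB x) mulrBl !mulrBr.
  rewrite (falg_disjoint_mul (pos_part_disjoint x)).
  rewrite (falg_disjoint_mul (etrans (meetC _ _) (pos_part_disjoint x))).
  by rewrite subr0 sub0r opprK lo_addr_ge0// lo_mulr_ge0// pos_part_ge0.
by have := sq 1; rewrite mulr1.
Qed.

(** The tent of height one over the interval from [-1] to [1]. *)
Definition tent a : X := pos_part (1 - vabs a).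

(** The ramp that climbs from zero to one over the unit interval; tents are
    differences of consecutive ramps, so sums of tents telescope. *)
Definition ramp a : X := Order.meet (1 : X) (pos_part a).

Lemma tent_ge0 a : 0 <= tent a. Proof. exact: pos_part_ge0. Qed.

(** A tent is disjoint from [pos_part (vabs a - 1)], and it stays so after
    multiplication by any positive factor. *)
Lemma tent_local a z : 0 <= z -> tent a * z * vabs a <= tent a * z.
Proof.
move=> z0.
have va : vabs a <= pos_part (vabs a - 1) + 1 by rewrite -lo_leBlDr leUl.
apply: (le_trans (lo_ler_wpM2l _ va)); first by rewrite lo_mulr_ge0 ?tent_ge0.
rewrite mulrDr mulr1 falg_disjoint_mul3 ?add0r//.
by rewrite /tent -[1 - vabs a]opprB meetC pos_part_disjoint.
Qed.

Lemma ramp_ge0 a : 0 <= ramp a.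
Proof. by rewrite lexI falg_ge01 pos_part_ge0. Qed.

Lemma ramp_le1 a : ramp a <= 1. Proof. exact: leIl. Qed.

Lemma rampN a : ramp (- a) = 1 - ramp (a + 1).
Proof.
rewrite /ramp lo_oppr_meet addrC lo_joinD addNr /pos_part.
rewrite lo_oppr_join lo_meetD opprD addrNK oppr0 add0r.
by rewrite meetC lo_meetUl (meet_idPl falg_ge01) joinC.
Qed.

(** The positive and negative parts of [a] are disjoint, so their truncations at
    [1], which are [ramp a] and [1 - ramp (a + 1)], add up to the truncation of
    [vabs a]. *)
Lemma tentE a : tent a = ramp (a + 1) - ramp a.
Proof.
have -> : ramp (a + 1) = 1 - ramp (- a).
  by rewrite rampN opprB addrCA subrr addr0.
have dis : Order.meet (ramp a) (ramp (- a)) = 0.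
  by rewrite /ramp meetACA meetxx pos_part_disjoint; apply/meet_idPr/falg_ge01.
have := lo_join_meet (ramp a) (ramp (- a)).
rewrite dis addr0 -addrA -opprD => E; rewrite [ramp _ + _]addrC -E.
rewrite /ramp -!(meetC (pos_part _)) -lo_meetUl.
have -> : Order.join (pos_part a) (pos_part (- a)) = vabs a.
  by rewrite /pos_part joinACA joinxx; apply/join_idPl/vabs_ge0.
by rewrite lo_oppr_meet addrC lo_joinD addNr /tent /pos_part addrC.
Qed.

(** With [b] the left-hand side, [r *: b] is at most [a + r], and [b] is at most
    the positive part of [r *: b] because [r] is at least [1]. *)
Lemma ramp_lower (r : R) a : 1 <= r ->
  1 - r^-1 *: vabs a <= ramp (a + r *: (1 : X)).
Proof.
move=> r1; have r0 : 0 < r by exact: lt_le_trans r1.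
set b := 1 - _.
have b1 : b <= 1.
  rewrite lo_leBlDr -[X in X <= _]addr0 lo_leD// lo_scaler_ge0 ?vabs_ge0//.
  by rewrite invr_ge0 ltW.
rewrite lexI b1/=; apply: (@le_trans _ _ (pos_part b)); first exact: leUl.
have h : pos_part b <= r *: pos_part b.
  rewrite -{1}[pos_part b](@scale1r R); apply: lo_ler_wpZr => //.
  exact: pos_part_ge0.
apply: (le_trans h); rewrite /pos_part lo_joinZ ?(ltW r0)// scaler0 leU2//.
rewrite /b scalerBr scalerA divff ?gt_eqF// scale1r addrC lo_leD//.
by rewrite -[a in _ <= a]opprK lo_leN2 lerN_vabs.
Qed.

Lemma ramp_upper (r : R) a : 1 <= r ->
  ramp (a - r *: (1 : X)) <= r^-1 *: vabs a.
Proof.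
move=> r1; have r0 : 0 < r by exact: lt_le_trans r1.
rewrite -[a - _]opprB rampN lo_leBlDr addrC -lo_leBlDr.
have r2 : 1 <= r + 1 by rewrite lerDr ltW.
have := @ramp_lower (r + 1) (- a) r2; rewrite vabsN.
rewrite scalerDl scale1r addrA [- a + _]addrC; apply: le_trans.
rewrite lo_leD// lo_leN2 lo_ler_wpZr ?vabs_ge0// lef_pV2 ?posrE ?addr_gt0//.
by rewrite lerDl.
Qed.

Variable Y : set X.
Hypotheses (hY : sublattice_algebra Y) (Y1 : Y 1).

(** Tents of half-width [delta] centred at the points of a long enough
    arithmetic progression. The bound is stated with an arbitrary factor [z]
    in the middle because it serves to prove commutativity. *)
Lemma tent_partition y (delta eta : R) : Y y -> 0 < delta -> 0 < eta ->
  exists (I : finType) (c : I -> R) (psi : I -> X),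
    [/\ forall i, Y (psi i) /\ 0 <= psi i,
        forall i z, 0 <= z ->
          psi i * z * vabs (y - c i *: (1 : X)) <= delta *: (psi i * z),
        \sum_i psi i <= 1 & 1 - \sum_i psi i <= eta *: vabs y].
Proof.
move=> Yy d0 e0.
(* The centres run from [1 - J] to [J] in units of [delta], and each end
   contributes at most [vabs y / (delta * J)] to the defect. *)
have [J [J1 hJ]] : exists J : nat, 1 <= J%:R :> R /\ 2 <= J%:R * (delta * eta).
  exists (Num.truncn (2 / (delta * eta))).+1; split; first by rewrite ler1n.
  by rewrite -ler_pdivrMr ?mulr_gt0// ltW// truncnS_gt.
pose a := delta^-1 *: y.
pose c (i : 'I_(J + J)) : R := delta * (i.+1%:R - J%:R).
pose psi (i : 'I_(J + J)) := tent (delta^-1 *: (y - c i *: (1 : X))).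
have cE i : delta^-1 *: (y - c i *: (1 : X)) = a + (J%:R - i.+1%:R) *: (1 : X).
  rewrite scalerBr scalerA /c mulrA mulVf ?gt_eqF// mul1r -scaleNr.
  by rewrite opprB.
have sumE : \sum_i psi i =
    ramp (a + J%:R *: (1 : X)) - ramp (a - J%:R *: (1 : X)).
  pose F i : X := ramp (a + (J%:R - i%:R) *: (1 : X)).
  rewrite (eq_bigr (fun i : 'I_(J + J) => - (F i.+1 - F i))); last first.
    move=> i _; rewrite /psi cE tentE opprB /F; congr (ramp _ - _).
    rewrite -addrA -[X in (_ + (_ + X))](@scale1r R) -scalerDl -natr1.
    by rewrite opprD addrA subrK.
  rewrite sumrN -(big_mkord xpredT (fun i => F i.+1 - F i)) telescope_sumr//.
  by rewrite opprB /F subr0 natrD opprD addrA subrr sub0r scaleNr.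
exists 'I_(J + J), c, psi; split.
- move=> i; split; last exact: tent_ge0.
  apply: (sublat_pos_part hY); apply: (sublatB hY) => //.
  apply: (sublat_vabs hY).
  by apply: (sublatZ hY); apply: (sublatB hY) => //; exact: (sublatZ hY).
- move=> i z z0.
  have := tent_local (delta^-1 *: (y - c i *: (1 : X))) z0.
  move/(lo_ler_wpZl (ltW d0)).
  rewrite vabsZ ger0_norm ?invr_ge0 ?(ltW d0)// lo_mulZr scalerA.
  by rewrite divff ?gt_eqF// scale1r.
- rewrite sumE lo_leBlDr (le_trans (ramp_le1 _))// -[X in X <= _]addr0.
  by rewrite lo_leD// ramp_ge0.
- rewrite sumE opprB addrCA addrC.
  have h1 := ramp_lower a J1; have h2 := ramp_upper a J1.
  rewrite lo_leBlDr addrC -lo_leBlDr in h1.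
  apply: (le_trans (lo_leD h1 h2)); rewrite -scalerDl vabsZ scalerA.
  apply: lo_ler_wpZr; last exact: vabs_ge0.
  have -> : J%:R^-1 + J%:R^-1 = 2 * J%:R^-1 :> R by rewrite mulr_natl mulr2n.
  rewrite gtr0_norm ?invr_gt0// -mulrA -invfM ler_pdivrMr.
    by rewrite mulrC -mulrA.
  by rewrite mulr_gt0// (lt_le_trans ltr01).
Qed.

End FAlgebra.

(** * Commutativity and partitions of unity for tuples *)

Section Commutativity.
Context {R : realType} {X : loAlgType R} (hX : archimedean X) (fX : falg X).
Implicit Types x y z : X.

(** On each tent of a fine partition of unity for [y], both [y * z] and [z * y]
    are close to the same multiple of [z]. *)
Lemma falg_mulC x y : x * y = y * x.
Proof.
suff H z : 0 <= z -> x * z = z * x.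
  rewrite -(pos_partB y) mulrBr mulrBl.
  by rewrite !H ?pos_part_ge0.
move=> z0; apply: (archimedean_eq hX
  (z := (z + z) + vabs x * vabs (x * z - z * x))) => eps e0.
have hT : sublattice_algebra [set: X] by [].
have [I [c [psi [psi0 psiloc sum1 sumx]]]] :=
  tent_partition fX hT Logic.I (y := x) Logic.I e0 e0.
set w := x * z - z * x.
have v1 : vabs (1 - \sum_i psi i) <= eps *: vabs x.
  by rewrite vabs_ge0_id// lo_subr_ge0.
have wE : w = \sum_i psi i * w + (1 - \sum_i psi i) * w.
  by rewrite -mulr_suml -mulrDl addrC subrK mul1r.
rewrite {1}wE (le_trans (vabsD _ _))// scalerDr lo_leD//; last first.
  apply: (le_trans (vabsM _ _)); rewrite -lo_mulZl.
  by apply: lo_ler_wpM2r => //; exact: vabs_ge0.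
apply: (le_trans (vabs_sum _ _ _)).
apply: (@le_trans _ _ (\sum_i (eps *: (psi i * z) + eps *: (psi i * z)))).
  apply: lo_le_sum => i _; have [_ p0] := psi0 i.
  have -> : psi i * w = psi i * (x - c i *: (1 : X)) * z
                       - psi i * z * (x - c i *: (1 : X)).
    rewrite /w !(mulrBr, mulrBl) !(lo_mulZr, lo_mulZl) !mulr1 !mulrA.
    by rewrite opprB addrA subrK.
  apply: (le_trans (vabsB _ _)); apply: lo_leD.
    apply: (le_trans (vabsM _ _)); rewrite (vabs_ge0_id z0) -lo_mulZl.
    apply: lo_ler_wpM2r => //; apply: (le_trans (vabsM _ _)).
    by rewrite (vabs_ge0_id p0) -(mulr1 (psi i)) psiloc// (falg_ge01 fX).
  apply: (le_trans (vabsM _ _)); rewrite vabs_ge0_id ?psiloc//.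
  exact: lo_mulr_ge0.
rewrite big_split/= -scaler_sumr -mulr_suml -scalerDr; apply: lo_ler_wpZl.
  exact: ltW.
have h : (\sum_i psi i) * z <= z.
  by rewrite -[X in _ <= X]mul1r; exact: lo_ler_wpM2r.
exact: lo_leD.
Qed.

End Commutativity.

Section Weight.
Context {R : realType} {X : loAlgType R}.

(** In an algebra of functions, this says that [psi] vanishes wherever the tuple
    [x] is farther than [delta] from [v]. *)
Definition localized n (x : 'I_n -> X) (delta : R) (v : 'rV[R]_n) (psi : X) :=
  0 <= psi /\
  forall i, psi * vabs (x i - v ord0 i *: (1 : X)) <= delta *: psi.

Definition weight n (x : 'I_n -> X) : X := 1 + \sum_i vabs (x i).

End Weight.

Section Partition.
Context {R : realType} {X : loAlgType R} (hX : archimedean X) (fX : falg X).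
Variables (n : nat) (x : 'I_n -> X).
Variable Y : set X.
Hypotheses (hY : sublattice_algebra Y) (Y1 : Y 1) (Yx : forall i, Y (x i)).

Let mulC := falg_mulC hX fX.

(** Products of one-variable partitions of unity: [1 - p * q] is
    [(1 - p) + p * (1 - q)], so the defects add up. The localizers are found in
    any sublattice-algebra [Y] that contains [1] and the tuple. *)
Lemma localized_partition (delta eta : R) : 0 < delta -> 0 < eta ->
  exists (I : finType) (v : I -> 'rV[R]_n) (psi : I -> X),
    [/\ forall i, Y (psi i), forall i, localized x delta (v i) (psi i),
        \sum_i psi i <= 1 & 1 - \sum_i psi i <= eta *: weight x].
Proof.
move=> d0 e0; have p1 := falg_ge01 fX.
suff [I [v [psi [Ypsi psi0 loc [sum1 sumx]]]]] :
    exists (I : finType) (v : I -> 'I_n -> R) (psi : I -> X),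
    [/\ forall i, Y (psi i), forall i, 0 <= psi i, forall i j,
          psi i * vabs (x j - v i j *: (1 : X)) <= delta *: psi i
        & \sum_i psi i <= 1 /\
          1 - \sum_i psi i <= eta *: \sum_j vabs (x j)].
  exists I, (fun i => \row_j v i j), psi; split => //.
    by move=> i; split => // j; rewrite mxE.
  apply: (le_trans sumx); apply: lo_ler_wpZl; first exact: ltW.
  by rewrite /weight -[X in X <= _]add0r lo_leD.
suff: forall l : seq 'I_n,
    exists (I : finType) (v : I -> 'I_n -> R) (psi : I -> X),
    [/\ forall i, Y (psi i), forall i, 0 <= psi i, forall i j, j \in l ->
          psi i * vabs (x j - v i j *: (1 : X)) <= delta *: psi i
        & \sum_i psi i <= 1 /\
          1 - \sum_i psi i <= eta *: \sum_(j <- l) vabs (x j)].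
  move=> /(_ (index_enum 'I_n)) [I [v [psi [? ? loc ?]]]].
  by exists I, v, psi; split => // i j; apply: loc; rewrite mem_index_enum.
elim=> [|k l [I [v [psi [Ypsi psi0 loc [sum1 sumx]]]]]].
  exists unit, (fun _ _ => 0), (fun=> 1); split => //.
  by rewrite big_const card_unit/= addr0 subrr big_nil scaler0.
have [J [c [phi [phi0 philoc sumphi1 sumphi]]]] :=
  tent_partition fX hY Y1 (Yx k) d0 e0.
exists (I * J)%type, (fun ij j => if j == k then c ij.2 else v ij.1 j),
  (fun ij => psi ij.1 * phi ij.2).
have sumE : \sum_(ij : I * J) psi ij.1 * phi ij.2 =
    (\sum_i psi i) * (\sum_j phi j).
  rewrite mulr_suml (eq_bigr (fun i => \sum_j psi i * phi j)); last first.
    by move=> i _; rewrite mulr_sumr.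
  by rewrite (pair_bigA _ (fun i j => psi i * phi j)).
have psisum0 : 0 <= \sum_i psi i by exact: lo_sum_ge0.
split.
- by move=> ij; apply: (sublatM hY); [exact: Ypsi|exact: (phi0 _).1].
- by move=> ij; apply: lo_mulr_ge0 => //; exact: (phi0 _).2.
- move=> [i j] h /=; have [Yp p0] := phi0 j.
  rewrite inE; case: eqVneq => [-> _|hk /= hl].
    rewrite -mulrA -lo_mulZr; apply: lo_ler_wpM2l => //.
    by rewrite -(mulr1 (phi j)) philoc.
  rewrite -mulrA (mulC (phi j)) mulrA -lo_mulZl.
  by apply: lo_ler_wpM2r => //; exact: loc.
- rewrite sumE; split.
    apply: (le_trans _ sum1); rewrite -[X in _ <= X]mulr1.
    exact: lo_ler_wpM2l.
  rewrite big_cons [vabs _ + _]addrC scalerDr.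
  have -> : 1 - (\sum_i psi i) * (\sum_j phi j) =
     (1 - \sum_i psi i) + (\sum_i psi i) * (1 - \sum_j phi j).
    by rewrite mulrBr mulr1 addrA subrK.
  apply: lo_leD => //; apply: (le_trans _ sumphi).
  rewrite -[X in _ <= X]mul1r; apply: lo_ler_wpM2r => //.
  by rewrite lo_subr_ge0.
Qed.

End Partition.

(** * Moduli of continuity relative to the weight *)

Section Modulus.
Context {R : realType} {n : nat}.
Implicit Types (u v t : 'rV[R]_n) (g : 'rV[R]_n -> R).

Definition wt t : R := 1 + \sum_(i < n) `|t ord0 i|.

Lemma wt_ge1 t : 1 <= wt t.
Proof. by rewrite lerDl sumr_ge0. Qed.

Lemma wt_ge0 t : 0 <= wt t.
Proof. exact: le_trans ler01 (wt_ge1 t). Qed.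

Definition near_within (delta : R) u v :=
  forall i, `|u ord0 i - v ord0 i| <= delta.

Lemma wt_near_within (delta : R) u v : delta *+ n <= 1 ->
  near_within delta u v -> wt v <= 2 * wt u.
Proof.
move=> dn uv; have h : \sum_i `|v ord0 i| <= \sum_i (`|u ord0 i| + delta).
  apply: ler_sum => i _; rewrite -lerBlDl.
  by rewrite (le_trans (lerB_dist _ _))// distrC uv.
move: h; rewrite big_split/= sumr_const card_ord => h.
have := wt_ge1 u; rewrite /wt in h * => w1; lra.
Qed.

Lemma uniform_on_box g (r eps : R) : continuous g -> 0 < eps ->
  exists2 delta : R, 0 < delta & forall u v,
    (forall i, `|u ord0 i| <= r) -> near_within delta u v ->
    `|g u - g v| <= eps.
Proof.
move=> cg e0.
pose K : set 'rV[R]_n := [set u | forall i, `[- r, r]%classic (u ord0 i)].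
have cK : compact K.
  apply: (@rV_compact R n (fun=> `[- r, r]%classic)) => i.
  exact: segment_compact.
pose P (d : R) u := forall v, near_within d u v -> `|g u - g v| <= eps.
have h : forall u, K u -> \forall u' \near u & d \near 0^'+, P d u'.
  move=> u _.
  have := cg u => /cvgrPdist_lt /(_ (eps / 2) (divr_gt0 e0 (ltr0n _ 2))).
  move=> /nbhs_ballP[rho /= rho0 hrho].
  exists (ball u (rho / 2), [set d : R | d < rho / 2]) => /=.
    split; first by apply: nbhsx_ballx; rewrite divr_gt0.
    by apply: nbhs_right_lt; rewrite divr_gt0.
  move=> [u' d] /= [bu dr] v du.
  have b1 : ball u rho u'.
    by apply: le_ball bu; rewrite ler_pdivrMr// ler_peMr ?ler1n// ltW.
  have b2 : ball u rho v.
    split => // i j; rewrite (ord1 i) {i}; have := bu.2 ord0 j.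
    rewrite /ball/= => b.
    apply: (le_lt_trans (ler_distD (u' ord0 j) _ _)).
    have := du j => dj; lra.
  have {b1}/= := hrho _ b1; have {b2}/= := hrho _ b2.
  move=> g1 g2; rewrite (le_trans (ler_distD (g u) _ _))//.
  rewrite distrC; lra.
have H : \forall d \near 0^'+, K `<=` P d.
  by apply: ((compact_near_coveringP K).1 cK).
have [d [d0 hd]] : exists d : R, 0 < d /\ K `<=` P d.
  near (0:R)^'+ => d; exists d; split; first by near: d; exact: nbhs_right_gt.
  by near: d.
exists d => // u v ur uv; apply: hd => // i.
by rewrite /= in_itv/= -ler_norml.
Unshelve. all: by end_near.
Qed.

(** A function of polynomial growth is uniformly continuous relative to some
    power of the weight: compactness gives this on a box, and outside of a
    large box an extra factor of the weight beats the growth of [g]. *)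
Lemma weighted_modulus g : continuous g -> polynomial_growth g ->
  exists N : nat, forall eps : R, 0 < eps ->
    exists2 delta : R, 0 < delta & forall u v,
      near_within delta u v -> `|g u - g v| <= eps * wt u ^+ N.
Proof.
move=> cg [N [M [_ M0 gM]]]; exists N.+1 => eps e0.
(* Outside of the box, [g u] and [g v] are bounded separately; the weights at
   [u] and [v] differ by a factor of at most [2]. *)
pose r := M * (1 + 2 ^+ N) / eps.
have [d1 d10 hd1] := uniform_on_box r cg e0.
pose d2 : R := n.+1%:R^-1.
have d20 : 0 < d2 by rewrite invr_gt0 ltr0n.
have d2n : d2 *+ n <= 1.
  by rewrite -mulr_natl ler_pdivrMr ?ltr0n// mul1r ler_nat.
exists (Num.min d1 d2); first by rewrite lt_min d10.
move=> u v uv.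
have uv1 : near_within d1 u v.
  by move=> i; rewrite (le_trans (uv i))// ge_min lexx.
have uv2 : near_within d2 u v.
  by move=> i; rewrite (le_trans (uv i))// ge_min lexx orbT.
have w1 := wt_ge1 u.
have [ur|ru] := leP (wt u) r.
  apply: (@le_trans _ _ eps); last first.
    by rewrite ler_peMr //; [exact: ltW|exact: exprn_ege1].
  apply: hd1 => // i; apply: le_trans ur.
  by rewrite /wt (bigD1 i)//= addrCA lerDl addr_ge0// sumr_ge0//.
have wv := wt_near_within d2n uv2.
apply: (@le_trans _ _ (M * (1 + 2 ^+ N) * wt u ^+ N)); last first.
  rewrite exprS mulrA; apply: ler_wpM2r; first by rewrite exprn_ge0// wt_ge0.
  by rewrite [leRHS]mulrC -ler_pdivrMr//; exact: ltW.
apply: (le_trans (ler_normB _ _)).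
rewrite -mulrA mulrDl mul1r mulrDr lerD ?gM//.
apply: (le_trans (gM v)); apply: ler_wpM2l => //.
by rewrite -exprMn lerXn2r// nnegrE ?mulr_ge0// wt_ge0.
Qed.

End Modulus.

(** * Localization and representation of functions *)

Section Powers.
Context {R : realType} {X : loAlgType R} (p1 : 0 <= 1 :> X).
Implicit Types x y : X.

Lemma lo_exprn_ge0 x N : 0 <= x -> 0 <= x ^+ N.
Proof.
by move=> x0; elim: N => [|N IH]; rewrite ?expr0// exprS lo_mulr_ge0.
Qed.

Lemma lo_ler_exprn x y N : 0 <= x -> x <= y -> x ^+ N <= y ^+ N.
Proof.
move=> x0 xy; elim: N => [//|N IH]; rewrite !exprS.
apply: (le_trans (lo_ler_wpM2l x0 IH)); apply: lo_ler_wpM2r => //.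
by apply: lo_exprn_ge0; exact: le_trans xy.
Qed.

Lemma lo_ler_weXn2l x M N : (1 : X) <= x -> (M <= N)%N -> x ^+ M <= x ^+ N.
Proof.
move=> x1 /subnK <-; have x0 : 0 <= x by exact: le_trans x1.
rewrite exprD -[X in X <= _]mul1r; apply: lo_ler_wpM2r.
  exact: lo_exprn_ge0.
by rewrite -(expr1n X (N - M)); exact: lo_ler_exprn.
Qed.

Lemma lo_exprZn (a : R) x N : (a *: x) ^+ N = a ^+ N *: x ^+ N.
Proof.
elim: N => [|N IH]; first by rewrite !expr0 scale1r.
by rewrite !exprS IH lo_mulZl lo_mulZr scalerA.
Qed.

Lemma vabs_scale1 (a : R) : vabs (a *: (1 : X)) = `|a| *: (1 : X).
Proof. by rewrite vabsZ vabs_ge0_id. Qed.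

Lemma lo_mul_shift (s t : R) x y :
  (x + s *: (1 : X)) * (y + t *: (1 : X)) - (s * t) *: (1 : X) =
  x * y + s *: y + t *: x.
Proof.
rewrite mulrDl !mulrDr !lo_mulZl !lo_mulZr !mul1r mulr1 scalerA.
by rewrite !addrA addrK addrAC.
Qed.

Lemma lo_join_scale1 (a b : R) :
  Order.join (a *: (1 : X)) (b *: (1 : X)) = Num.max a b *: (1 : X).
Proof.
have [ab|/ltW ba] := leP a b; first by apply/join_idPr; exact: lo_ler_wpZr.
by apply/join_idPl; exact: lo_ler_wpZr.
Qed.

Lemma weight_ge1 n (x : 'I_n -> X) : (1 : X) <= weight x.
Proof.
rewrite -[X in X <= _]addr0; apply: lo_leD => //.
by apply: lo_sum_ge0 => i _; exact: vabs_ge0.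
Qed.

Lemma weight_ge0 n (x : 'I_n -> X) : 0 <= weight x.
Proof. exact: le_trans p1 (weight_ge1 x). Qed.

End Powers.

Section Localization.
Context {R : realType} {X : loAlgType R} (hX : archimedean X) (fX : falg X).
Variables (n : nat) (x : 'I_n -> X).
Implicit Types (y z psi phi : X) (u v : 'rV[R]_n) (g h : 'rV[R]_n -> R).

Let mulC := falg_mulC hX fX.
Let p1 : 0 <= 1 :> X := falg_ge01 fX.
Let W := weight x.

Let WN0 N : 0 <= W ^+ N.
Proof. by apply: lo_exprn_ge0 => //; exact: weight_ge0. Qed.

Let WNM M N : (M <= N)%N -> W ^+ M <= W ^+ N.
Proof. by apply: lo_ler_weXn2l => //; exact: weight_ge1. Qed.

Let psiWNM psi M N : 0 <= psi -> (M <= N)%N -> psi * W ^+ M <= psi * W ^+ N.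
Proof. by move=> p0 MN; apply: lo_ler_wpM2l => //; exact: WNM. Qed.

Lemma localized_weaken (d d' : R) v psi : d <= d' ->
  localized x d v psi -> localized x d' v psi.
Proof.
move=> dd [p0 ploc]; split => // i; apply: (le_trans (ploc i)).
exact: lo_ler_wpZr.
Qed.

(** The required sharpness [d] does not depend on the point [v]. *)
Definition locally_holds (P : 'rV[R]_n -> X -> Prop) : Prop :=
  exists2 d : R, 0 < d & forall v psi, localized x d v psi -> P v psi.

Lemma locally_holds2 P Q S : locally_holds P -> locally_holds Q ->
  (forall v psi, 0 <= psi -> P v psi -> Q v psi -> S v psi) -> locally_holds S.
Proof.
move=> [d d0 hd] [e e0 he] PQS.
exists (Num.min d e); first by rewrite lt_min d0.
move=> v psi loc; apply: PQS; first exact: loc.1.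
- by apply: hd; apply: localized_weaken loc; rewrite ge_min lexx.
- by apply: he; apply: localized_weaken loc; rewrite ge_min lexx orbT.
Qed.

(** Under the product, the distance from [v] to [u] in each coordinate is at
    most the sum of their distances from [x i], hence at most [d + e]. *)
Lemma localized_overlap (d e : R) v u psi phi :
  localized x d v psi -> localized x e u phi ->
  near_within (d + e) v u \/ psi * phi = 0.
Proof.
move=> [psi0 psiloc] [phi0 philoc].
have [[i /negP]|] := pselect (exists i, ~ (`|v ord0 i - u ord0 i| <= d + e));
  last first.
  by move=> /forallNP H; left => i; have := H i => /contrapT.
rewrite -ltNge => vu; right; have pp0 := lo_mulr_ge0 psi0 phi0.
have h : `|v ord0 i - u ord0 i| *: (psi * phi) <= (d + e) *: (psi * phi).
  apply: (@le_trans _ _ (psi * phi * (vabs (x i - v ord0 i *: (1 : X))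
                               + vabs (x i - u ord0 i *: (1 : X))))).
    rewrite -[X in _ *: X]mulr1 -lo_mulZr -vabs_scale1//.
    apply: lo_ler_wpM2l => //; rewrite scalerBl (vabs_subC (x i)).
    exact: vabs_dist.
  rewrite mulrDr scalerDl; apply: lo_leD.
    rewrite -mulrA (mulC phi) mulrA -lo_mulZl; apply: lo_ler_wpM2r => //.
  by rewrite -mulrA -lo_mulZr; apply: lo_ler_wpM2l.
apply/le_anti; rewrite pp0 andbT.
have k0 : 0 < `|v ord0 i - u ord0 i| - (d + e) by rewrite subr_gt0.
have {}h : (`|v ord0 i - u ord0 i| - (d + e)) *: (psi * phi) <= 0.
  by rewrite scalerBl lo_leBlDr add0r.
have := lo_ler_wpZl (ltW (etrans (invr_gt0 _) k0)) h.
by rewrite scalerA mulVf ?gt_eqF// scale1r scaler0.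
Qed.

(* This sharpness makes the [n] coordinate errors add up to at most [1]. *)
Let d1 : R := n.+1%:R^-1.

Let d1_gt0 : 0 < d1. Proof. by rewrite invr_gt0 ltr0n. Qed.

(** On a localizer at [v], the weight of [v] exceeds [W] by at most [1], and [1]
    is at most [W]. *)
Lemma locally_weight N : locally_holds
  (fun v psi => wt v ^+ N *: psi <= 2 ^+ N *: (psi * W ^+ N)).
Proof.
exists d1 => // v psi [p0 ploc].
have d1n : d1 *+ n <= 1.
  by rewrite -mulr_natl ler_pdivrMr ?ltr0n// mul1r ler_nat.
have psiW : psi <= psi * W.
  by rewrite -[X in X <= _]mulr1; apply: lo_ler_wpM2l => //; exact: weight_ge1.
have one : wt v *: psi <= 2 *: (psi * W).
  have -> : 2 *: (psi * W) = psi * W + psi * W :> X.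
    by rewrite -[2]/(1 + 1) scalerDl scale1r.
  rewrite scalerDl scale1r; apply: lo_leD => //.
  apply: (@le_trans _ _ (\sum_i (d1 *: psi + psi * vabs (x i)))).
    rewrite scaler_suml; apply: lo_le_sum => i _.
    rewrite -{1}[psi]mulr1 -lo_mulZr -vabs_scale1//.
    apply: (@le_trans _ _
      (psi * (vabs (x i - v ord0 i *: (1 : X)) + vabs (x i)))).
      apply: lo_ler_wpM2l => //; rewrite vabs_subC.
      by apply: (le_trans _ (vabsD _ _)); rewrite subrK.
    by rewrite mulrDr; apply: lo_leD.
  rewrite big_split/= sumr_const card_ord scalerMnl -mulr_sumr.
  rewrite /W /weight mulrDr mulr1; apply: lo_leD => //.
  by rewrite -[X in _ <= X](@scale1r R); exact: lo_ler_wpZr.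
elim: N => [|N IH]; first by rewrite !expr0 mulr1.
rewrite exprS -scalerA; apply: (le_trans (lo_ler_wpZl (wt_ge0 _) IH)).
rewrite scalerA mulrC -scalerA -lo_mulZl exprSr -[X in _ <= X]scalerA.
apply: lo_ler_wpZl; first exact: exprn_ge0.
by rewrite exprS mulrA -lo_mulZl; exact: lo_ler_wpM2r.
Qed.

Lemma locally_growth g : polynomial_growth g ->
  exists N : nat, exists2 C : R, 0 <= C &
    locally_holds (fun v psi => `|g v| *: psi <= C *: (psi * W ^+ N)).
Proof.
move=> [N [M [_ M0 gM]]]; exists N, (M * 2 ^+ N).
  by rewrite mulr_ge0// exprn_ge0.
have [d d0 hd] := locally_weight N; exists d => // v psi loc.
apply: (le_trans (lo_ler_wpZr (gM v) loc.1)).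
by rewrite -!scalerA; apply: lo_ler_wpZl => //; exact: hd.
Qed.

(** Summing a local bound over a fine partition of unity gives a global one;
    the defect of the partition is absorbed by the Archimedean property. *)
Lemma local_bound y (c : R) N : 0 <= c ->
  locally_holds (fun v psi => psi * vabs y <= c *: (psi * W ^+ N)) ->
  vabs y <= c *: W ^+ N.
Proof.
move=> c0 [d d0 hd].
apply: (archimedean_le hX (z := W * vabs y)) => eps e0.
have hT : sublattice_algebra [set: X] by [].
have [I [v [psi [_ loc sum1 sumx]]]] :=
  localized_partition hX fX hT Logic.I (fun=> Logic.I) d0 e0 (x := x).
rewrite -{1}(mul1r (vabs y)) -(subrK (\sum_i psi i) 1) mulrDl addrC.
apply: lo_leD; last first.
  by rewrite -lo_mulZl; apply: lo_ler_wpM2r => //; exact: vabs_ge0.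
rewrite mulr_suml; apply: (@le_trans _ _ (\sum_i c *: (psi i * W ^+ N))).
  by apply: lo_le_sum => i _; exact: hd.
rewrite -scaler_sumr -mulr_suml; apply: lo_ler_wpZl => //.
by rewrite -[X in _ <= X]mul1r; exact: lo_ler_wpM2r.
Qed.

(** The error is relative to a power of the weight because a function of
    polynomial growth is uniformly continuous only in that sense. *)
Definition approximates N (eps : R) g y : Prop :=
  locally_holds (fun v psi =>
    psi * vabs (y - g v *: (1 : X)) <= eps *: (psi * W ^+ N)).

Definition represents g y : Prop :=
  exists N, forall eps : R, 0 < eps -> approximates N eps g y.

Lemma approximates_weaken M N eps g y : 0 <= eps -> (M <= N)%N ->
  approximates M eps g y -> approximates N eps g y.
Proof.
move=> e0 MN [d d0 hd]; exists d => // v psi loc.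
apply: (le_trans (hd _ _ loc)); apply: lo_ler_wpZl => //.
by apply: psiWNM => //; exact: loc.1.
Qed.

Lemma represents_weaken g y N0 : represents g y ->
  exists2 N, (N0 <= N)%N & forall eps : R, 0 < eps -> approximates N eps g y.
Proof.
move=> [N H]; exists (maxn N0 N); first exact: leq_maxl.
move=> eps e0; apply: (approximates_weaken (ltW e0) (leq_maxr _ _)).
exact: H.
Qed.

Lemma represents2 g h y z : represents g y -> represents h z ->
  exists N, forall eps : R, 0 < eps ->
    approximates N eps g y /\ approximates N eps h z.
Proof.
move=> [N rg] /(represents_weaken N)[M NM rh]; exists M => eps e0; split.
  by apply: (approximates_weaken (ltW e0) NM); exact: rg.
exact: rh.
Qed.

Lemma approximates_dist N (a b : R) g y z : 0 <= a -> 0 <= b ->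
  approximates N a g y -> approximates N b g z ->
  vabs (y - z) <= (a + b) *: W ^+ N.
Proof.
move=> a0 b0 ga gb; apply: local_bound; first exact: addr_ge0.
apply: (locally_holds2 ga gb) => v psi psi0 ya zb.
apply: (@le_trans _ _
    (psi * (vabs (y - g v *: (1 : X)) + vabs (g v *: (1 : X) - z)))).
  by apply: lo_ler_wpM2l => //; exact: vabs_dist.
by rewrite mulrDr scalerDl (vabs_subC (_ *: _) z) lo_leD.
Qed.

Lemma represents_inj g y z : represents g y -> represents g z -> y = z.
Proof.
move=> gy gz; have [N H] := represents2 gy gz.
apply: (archimedean_eq hX (z := W ^+ N + W ^+ N)) => eps e0.
have [yN zN] := H _ e0.
rewrite scalerDr -scalerDl.
by apply: (approximates_dist _ _ yN zN); exact: ltW.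
Qed.

Lemma represents_one : represents (fun=> 1) 1.
Proof.
exists 0%N => eps e0; exists 1 => // v psi [p0 _].
rewrite scale1r subrr vabs0 mulr0 lo_scaler_ge0 ?(ltW e0)//.
by rewrite expr0 mulr1.
Qed.

Lemma represents_proj i : represents (fun v => v ord0 i) (x i).
Proof.
exists 0%N => eps e0; exists eps => // v psi [p0 ploc].
by rewrite expr0 mulr1.
Qed.

Lemma represents_linear (a : R) g h y z : represents g y -> represents h z ->
  represents (fun v => a * g v + h v) (a *: y + z).
Proof.
move=> gy hz; have [N H] := represents2 gy hz; exists N => eps e0.
have k0 : 0 < `|a| + 1 by rewrite ltr_wpDl.
have [yN zN] := H _ (divr_gt0 e0 k0).
apply: (locally_holds2 yN zN) => v psi psi0 ya zb.
have -> : a *: y + z - (a * g v + h v) *: (1 : X) =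
    a *: (y - g v *: (1 : X)) + (z - h v *: (1 : X)).
  by rewrite scalerDl scalerBr -scalerA opprD addrACA.
apply: (le_trans (lo_ler_wpM2l psi0 (vabsD _ _))).
have -> : eps = `|a| * (eps / (`|a| + 1)) + eps / (`|a| + 1).
  by rewrite -[X in _ + X]mul1r -mulrDl mulrC divfK// gt_eqF.
rewrite mulrDr scalerDl lo_leD// vabsZ lo_mulZr -scalerA.
exact: lo_ler_wpZl.
Qed.

Lemma represents_join g h y z : represents g y -> represents h z ->
  represents (fun v => Num.max (g v) (h v)) (Order.join y z).
Proof.
move=> gy hz; have [N H] := represents2 gy hz; exists N => eps e0.
have e20 : 0 < eps / 2 by rewrite divr_gt0.
have [yN zN] := H _ e20.
apply: (locally_holds2 yN zN) => v psi psi0 ya zb.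
rewrite -lo_join_scale1//.
apply: (le_trans (lo_ler_wpM2l psi0 (vabs_join _ _ _ _))).
by rewrite mulrDr [eps]splitr scalerDl lo_leD.
Qed.

(** With [a = y - g v] and [b = z - h v], the error of the product is
    [a * b + g v *: b + h v *: a], and the values of [g] and [h] are locally
    bounded by powers of the weight. *)
Lemma represents_mul g h y z : polynomial_growth g -> polynomial_growth h ->
  represents g y -> represents h z ->
  represents (fun v => g v * h v) (y * z).
Proof.
move=> pg ph gy hz; have [N H] := represents2 gy hz.
have [Ng [C C0 hC]] := locally_growth pg.
have [Nh [D D0 hD]] := locally_growth ph.
pose M := maxn N (maxn Ng Nh).
have NM : (N <= M)%N by exact: leq_maxl.
have NgM : (Ng <= M)%N by rewrite /M !leq_max leqnn orbT.
have NhM : (Nh <= M)%N by rewrite /M !leq_max leqnn !orbT.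
exists (M + M)%N => eps e0.
pose k := 1 + C + D; have k0 : 0 < k by rewrite ltr_wpDr// ltr_wpDr.
pose t := eps / k; have t0 : 0 < t by rewrite divr_gt0.
have [yN zN] := H _ t0; have [_ z1] := H _ (ltr01 : 0 < 1 :> R).
have tg : locally_holds (fun v psi =>
    psi * vabs (y - g v *: (1 : X)) <= t *: (psi * W ^+ M) /\
    `|g v| *: psi <= C *: (psi * W ^+ M)).
  apply: (locally_holds2 yN hC) => v psi psi0 h1 h2; split.
    by apply: (le_trans h1); apply: lo_ler_wpZl; [exact: ltW|exact: psiWNM].
  by apply: (le_trans h2); apply: lo_ler_wpZl; [exact: C0|exact: psiWNM].
have th : locally_holds (fun v psi =>
    psi * vabs (z - h v *: (1 : X)) <= t *: (psi * W ^+ M) /\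
    `|h v| *: psi <= D *: (psi * W ^+ M)).
  apply: (locally_holds2 zN hD) => v psi psi0 h1 h2; split.
    by apply: (le_trans h1); apply: lo_ler_wpZl; [exact: ltW|exact: psiWNM].
  by apply: (le_trans h2); apply: lo_ler_wpZl; [exact: D0|exact: psiWNM].
have th1 : locally_holds (fun v psi =>
    psi * vabs (z - h v *: (1 : X)) <= psi * W ^+ M).
  have [d d0 hd] := z1; exists d => // v psi loc.
  apply: (le_trans (hd _ _ loc)); rewrite scale1r; apply: psiWNM => //.
  exact: loc.1.
have th2 := locally_holds2 th th1 (fun v psi _ a b => conj a b).
apply: (locally_holds2 tg th2) => v psi psi0 [yt gC] [[zt hD'] z1'].
set a := y - g v *: (1 : X) in yt *; set b := z - h v *: (1 : X) in zt z1' *.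
have -> : y * z - (g v * h v) *: (1 : X) = a * b + g v *: b + h v *: a.
  by rewrite -lo_mul_shift !subrK.
have -> : eps = t * 1 + C * t + D * t.
  by rewrite (mulrC t 1) -!mulrDl mulrC /t divfK// gt_eqF.
apply: (le_trans (lo_ler_wpM2l psi0 (vabsD _ _))).
rewrite mulrDr scalerDl; apply: lo_leD; last first.
  rewrite vabsZ lo_mulZr -lo_mulZl.
  apply: (le_trans (lo_ler_wpM2r (vabs_ge0 _) hD')).
  rewrite lo_mulZl -scalerA; apply: lo_ler_wpZl => //.
  rewrite -mulrA (mulC (W ^+ M)) mulrA exprD mulrA -lo_mulZl.
  exact: lo_ler_wpM2r.
apply: (le_trans (lo_ler_wpM2l psi0 (vabsD _ _))).
rewrite mulrDr scalerDl; apply: lo_leD; last first.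
  rewrite vabsZ lo_mulZr -lo_mulZl.
  apply: (le_trans (lo_ler_wpM2r (vabs_ge0 _) gC)).
  rewrite lo_mulZl -scalerA; apply: lo_ler_wpZl => //.
  rewrite -mulrA (mulC (W ^+ M)) mulrA exprD mulrA -lo_mulZl.
  exact: lo_ler_wpM2r.
apply: (le_trans (lo_ler_wpM2l psi0 (vabsM _ _))).
rewrite mulrA; apply: (le_trans (lo_ler_wpM2r (vabs_ge0 _) yt)).
rewrite lo_mulZl -scalerA; apply: lo_ler_wpZl; first exact: ltW.
rewrite scale1r -mulrA (mulC (W ^+ M)) mulrA exprD mulrA.
exact: lo_ler_wpM2r.
Qed.

End Localization.

(** * Interpolation and existence of the calculus *)

Section Approximation.
Context {R : realType} {X : loAlgType R} (hX : archimedean X) (fX : falg X).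
Variables (n : nat) (x : 'I_n -> X).
Implicit Types (y psi : X) (u v : 'rV[R]_n) (g : 'rV[R]_n -> R).

Let p1 : 0 <= 1 :> X := falg_ge01 fX.
Let W := weight x.

(** On a localizer at [u], only the nodes near [u] contribute to the interpolant
    of [g] along a partition of unity, and [g] is close to [g u] there. The
    defect of the partition is multiplied by [g u], so it is chosen small
    compared to the growth of [g]. *)
Lemma interpolation_approximates (Y : set X) (hY : sublattice_algebra Y)
    (Y1 : Y 1) (Yx : forall i, Y (x i)) g :
  continuous g -> polynomial_growth g ->
  exists N : nat, forall eps : R, 0 < eps -> exists y : X,
    [/\ Y y, exists C : R, vabs y <= C *: (1 : X) & approximates x N eps g y].
Proof.
move=> cg pg; have [N1 hmod] := weighted_modulus cg pg.
have [N2 [C C0 hC]] := locally_growth fX x pg.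
pose N := maxn N1 N2.+1.
exists N => eps e0; have e20 : 0 < eps / 2 by rewrite divr_gt0.
pose e1 := eps / 2 / 2 ^+ N1; have e10 : 0 < e1 by rewrite divr_gt0// exprn_gt0.
have [d d0 hd] := hmod _ e10.
pose eta := eps / 2 / (C + 1); have C10 : 0 < C + 1 by rewrite ltr_wpDl.
have eta0 : 0 < eta by rewrite divr_gt0.
have d20 : 0 < d / 2 by rewrite divr_gt0.
have [I [v [psi [Ypsi loc sum1 sumx]]]] :=
  localized_partition hX fX hY Y1 Yx d20 eta0.
have psi0 i : 0 <= psi i by case: (loc i).
have sum0 : 0 <= \sum_i psi i by exact: lo_sum_ge0.
exists (\sum_i g (v i) *: psi i); split.
- by apply: (sublat_sum hY) => i; exact: (sublatZ hY).
- exists (\sum_i `|g (v i)|); apply: (le_trans (vabs_sum _ _ _)).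
  rewrite scaler_suml; apply: lo_le_sum => i _.
  rewrite vabsZ vabs_ge0_id//; apply: lo_ler_wpZl => //.
  apply: (le_trans _ sum1); rewrite (bigD1 i)//= -[X in X <= _]addr0.
  by apply: lo_leD => //; exact: lo_sum_ge0.
have hloc : locally_holds x (fun u phi => localized x (d / 2) u phi).
  by exists (d / 2).
have hw := locally_weight fX x N1.
apply: (locally_holds2 (locally_holds2 hw hC (fun _ _ _ a b => conj a b)) hloc).
move=> u phi phi0 [wu gu] locu.
have -> : \sum_i g (v i) *: psi i - g u *: (1 : X) =
    \sum_i (g (v i) - g u) *: psi i - g u *: (1 - \sum_i psi i).
  under [in RHS]eq_bigr do rewrite scalerBl.
  by rewrite sumrB -scaler_sumr scalerBr opprB addrA subrK.
apply: (le_trans (lo_ler_wpM2l phi0 (vabsB _ _))).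
rewrite mulrDr [eps]splitr scalerDl; apply: lo_leD; last first.
  rewrite vabsZ (vabs_ge0_id (_ : 0 <= 1 - \sum_i psi i)) ?lo_subr_ge0//.
  rewrite lo_mulZr -lo_mulZl.
  have gp0 : 0 <= `|g u| *: phi by exact: lo_scaler_ge0.
  apply: (le_trans (lo_ler_wpM2l gp0 sumx)); rewrite lo_mulZr -/W.
  apply: (le_trans (lo_ler_wpZl (ltW eta0)
    (lo_ler_wpM2r (weight_ge0 p1 x) gu))).
  rewrite lo_mulZl scalerA -mulrA -exprSr.
  apply: (@le_trans _ _ ((eta * C) *: (phi * W ^+ N))).
    apply: lo_ler_wpZl; first by rewrite mulr_ge0// ltW.
    apply: lo_ler_wpM2l => //; apply: lo_ler_weXn2l => //.
      exact: weight_ge1.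
    exact: leq_maxr.
  apply: lo_ler_wpZr.
    rewrite /eta mulrAC ler_pdivrMr// ler_wpM2l ?ltW// ltrDl//.
  apply: lo_mulr_ge0 => //; apply: lo_exprn_ge0 => //; exact: weight_ge0.
apply: (le_trans (lo_ler_wpM2l phi0 (vabs_sum _ _ _))).
rewrite mulr_sumr.
apply: (@le_trans _ _ (\sum_i (e1 * wt u ^+ N1) *: (phi * psi i))).
  apply: lo_le_sum => i _; rewrite vabsZ (vabs_ge0_id (psi0 i)) lo_mulZr.
  have [uv|->] := localized_overlap hX fX locu (loc i); last first.
    by rewrite !scaler0.
  apply: lo_ler_wpZr; last exact: lo_mulr_ge0.
  by rewrite distrC; apply: hd; move: uv; rewrite -splitr.
rewrite -scaler_sumr -mulr_sumr -scalerA.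
have -> : eps / 2 = e1 * 2 ^+ N1 by rewrite divfK// gt_eqF// exprn_gt0.
rewrite -[X in _ <= X]scalerA; apply: lo_ler_wpZl; first exact: ltW.
apply: (@le_trans _ _ (wt u ^+ N1 *: phi)).
  apply: lo_ler_wpZl; first by rewrite exprn_ge0// wt_ge0.
  by rewrite -[X in _ <= X]mulr1; exact: lo_ler_wpM2l.
apply: (le_trans wu); apply: lo_ler_wpZl; first exact: exprn_ge0.
apply: lo_ler_wpM2l => //; apply: lo_ler_weXn2l => //.
  exact: weight_ge1.
exact: leq_maxl.
Qed.

(** Relatively uniform completeness with regulator [w], for sequences in the
    order ideal of [w]. *)
Definition order_complete_at (w : X) : Prop := forall u : nat -> X,
  (forall p, exists C : R, vabs (u p) <= C *: w) ->
  (forall eps : R, 0 < eps -> exists K : nat, forall p q : nat,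
     (K <= p)%N -> (K <= q)%N -> vabs (u p - u q) <= eps *: w) ->
  exists l : X, forall eps : R, 0 < eps -> exists K : nat, forall p : nat,
     (K <= p)%N -> vabs (u p - l) <= eps *: w.

(** Interpolants with errors [1 / (k + 1)] form a Cauchy sequence, because two
    elements that approximate the same function are close to each other; the
    limit inherits their local estimates. *)
Lemma represents_exists g : (forall N, order_complete_at (W ^+ N.+1)) ->
  continuous g -> polynomial_growth g -> exists y, represents x g y.
Proof.
move=> cX cg pg; have hT : sublattice_algebra [set: X] by [].
have [N0 H0] := interpolation_approximates hT Logic.I (fun=> Logic.I) cg pg.
pose N := N0.+1.
have /choice[y hy] (k : nat) : exists y : X,
    (exists C : R, vabs y <= C *: (1 : X)) /\ approximates x N k.+1%:R^-1 g y.
  have k0 : 0 < k.+1%:R^-1 :> R by rewrite invr_gt0 ltr0n.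
  have [y [_ yC ya]] := H0 _ k0; exists y; split => //.
  by apply: approximates_weaken ya => //; exact: ltW.
have small (eps : R) : 0 < eps -> exists K : nat, forall k, (K <= k)%N ->
    k.+1%:R^-1 <= eps.
  move=> e0; exists (Num.truncn eps^-1) => k kK.
  rewrite -[eps]invrK lef_pV2 ?posrE ?invr_gt0 ?ltr0n//.
  by apply: ltW; apply: (lt_le_trans (truncnS_gt _)); rewrite ler_nat.
have W1 : (1 : X) <= W ^+ N.
  by rewrite -(expr0 W); apply: lo_ler_weXn2l => //; exact: weight_ge1.
have WN0 : 0 <= W ^+ N by exact: le_trans W1.
have [||l hl] := cX N0 y.
- move=> p; have [[C yC] _] := hy p; exists `|C|; apply: (le_trans yC).
  apply: (@le_trans _ _ (`|C| *: (1 : X))).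
    exact: lo_ler_wpZr (ler_norm _) _.
  exact: lo_ler_wpZl.
- move=> eps e0; have [K hK] := small (eps / 2) (divr_gt0 e0 (ltr0n _ 2)).
  exists K => p q Kp Kq.
  apply: (le_trans (approximates_dist hX fX _ _ (hy p).2 (hy q).2)) => //.
  by apply: lo_ler_wpZr => //; rewrite [leRHS]splitr lerD// hK.
exists l, N => eps e0; have e20 := divr_gt0 e0 (ltr0n R 2).
have [K hK] := small _ e20; have [K' hK'] := hl _ e20.
pose p := maxn K K'.
have [d d0 hd] := (hy p).2; exists d => // v psi loc; have psi0 := loc.1.
apply: (@le_trans _ _ (psi * (vabs (y p - l) + vabs (y p - g v *: (1 : X))))).
  by apply: lo_ler_wpM2l => //; rewrite (vabs_subC _ l); exact: vabs_dist.
rewrite mulrDr [eps]splitr scalerDl; apply: lo_leD.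
  rewrite -lo_mulZr; apply: lo_ler_wpM2l => //; apply: hK'; exact: leq_maxr.
apply: (le_trans (hd _ _ loc)); apply: lo_ler_wpZr; last exact: lo_mulr_ge0.
by apply: hK; exact: leq_maxl.
Qed.

Lemma pgfunP (g : PG R n) :
  continuous (g : pgfun R n) /\ polynomial_growth (g : pgfun R n).
Proof. exact/asboolP/(pgfun_valP (g : pgfun R n)). Qed.

(** Sending [g] to the element that represents it preserves the operations
    because representation is compatible with them and the represented function
    determines the element. *)
Theorem calculus_exists : (forall N, order_complete_at (W ^+ N.+1)) ->
  exists Psi : PG R n -> X, [/\ lattice_algebra_hom Psi, Psi 1 = 1
      & forall i : 'I_n, Psi (pg_proj i) = x i].
Proof.
move=> cX.
have /choice[Psi hPsi] (g : PG R n) :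
    exists y, represents x (g : pgfun R n) y.
  by have [cg pg] := pgfunP g; exact: represents_exists.
have inj g y z : represents x g y -> represents x g z -> y = z.
  exact: represents_inj.
have lin : linear Psi.
  move=> a g h; apply: (inj _ _ _ (hPsi _)).
  exact: represents_linear (hPsi g) (hPsi h).
have join : {morph Psi : g h / Order.join g h}.
  move=> g h; apply: (inj _ _ _ (hPsi _)).
  rewrite (_ : pgfun_val _ =
    fun v => Num.max ((g : pgfun R n) v) ((h : pgfun R n) v)).
    exact: represents_join.
  by apply/funext => v; rewrite PG_joinE.
have D (g h : PG R n) : Psi (g + h) = Psi g + Psi h.
  by rewrite -[g](@scale1r R) lin !scale1r.
have B (g h : PG R n) : Psi (g - h) = Psi g - Psi h.
  by rewrite addrC -scaleN1r lin scaleN1r addrC.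
exists Psi; split; first split => //.
- by move=> g h; rewrite !lo_meetE B D join.
- move=> g h; apply: (inj _ _ _ (hPsi _)).
  have [_ pg] := pgfunP g; have [_ ph] := pgfunP h.
  exact: (represents_mul hX fX pg ph (hPsi g) (hPsi h)).
- by apply: (inj _ _ _ (hPsi _)); exact: represents_one.
- by move=> i; apply: (inj _ _ _ (hPsi _)); exact: represents_proj.
Qed.

End Approximation.

(** * Functions of polynomial growth and uniqueness of the calculus *)

Section Homomorphisms.
Context {R : realType} {A B : loAlgType R} (f : A -> B).
Hypothesis fhom : lattice_algebra_hom f.
Implicit Types x y : A.

Lemma lahomD x y : f (x + y) = f x + f y.
Proof. by rewrite -[x](@scale1r R) (lahom_linear fhom) !scale1r. Qed.

Lemma lahom0 : f 0 = 0.
Proof. by apply: (addrI (f 0)); rewrite -lahomD !addr0. Qed.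

Lemma lahomZ (a : R) x : f (a *: x) = a *: f x.
Proof. by rewrite -[_ *: x]addr0 (lahom_linear fhom) lahom0 addr0. Qed.

Lemma lahomN x : f (- x) = - f x.
Proof. by rewrite -scaleN1r lahomZ scaleN1r. Qed.

Lemma lahomB x y : f (x - y) = f x - f y.
Proof. by rewrite lahomD lahomN. Qed.

Lemma lahom_vabs x : f (vabs x) = vabs (f x).
Proof. by rewrite /vabs (lahom_join fhom) lahomN. Qed.

Lemma lahom_le x y : x <= y -> f x <= f y.
Proof. by move=> /join_idPr xy; rewrite -xy (lahom_join fhom) leUl. Qed.

Lemma lahom_ge0 x : 0 <= x -> 0 <= f x.
Proof. by move=> /lahom_le; rewrite lahom0. Qed.

Lemma lahom_expr (f1 : f 1 = 1) x N : f (x ^+ N) = f x ^+ N.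
Proof.
by elim: N => [|N IH]; rewrite ?expr0// !exprS (lahom_mul fhom) IH.
Qed.

End Homomorphisms.

Section PolynomialGrowthAlgebra.
Context {R : realType} {n : nat}.
Implicit Types (f g h psi : PG R n) (t u v : 'rV[R]_n).

Local Notation ev f t := ((f : pgfun R n) t).

Lemma PG_oppE f t : ev (- f) t = - ev f t. Proof. by []. Qed.

Lemma PG_vabsE f t : ev (vabs f) t = `|ev f t|.
Proof.
rewrite PG_joinE PG_oppE; have [f0|/ltW f0] := leP 0 (ev f t).
  by rewrite ger0_norm//; apply/max_idPl; rewrite (le_trans _ f0)// oppr_le0.
by rewrite ler0_norm//; apply/max_idPr; rewrite (le_trans f0)// oppr_ge0.
Qed.

Lemma PG_exprE f t N : ev (f ^+ N) t = ev f t ^+ N.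
Proof.
by elim: N => [|N IH]; rewrite ?expr0// !exprS PG_mulE IH.
Qed.

Lemma PG_weightE t : ev (weight (@pg_proj R n)) t = wt t.
Proof.
rewrite /weight PG_addE PG_oneE /wt; congr (_ + _).
elim/big_rec2: _ => [//|i y z _ IH].
by rewrite PG_addE PG_vabsE PG_projE IH.
Qed.

Lemma PG_archimedean : archimedean (PG R n).
Proof.
move=> f g /PG_leP f0 fg; apply: pg_ext => t; apply/eqP; rewrite eq_le.
apply/andP; split; last exact: f0.
rewrite leNgt; apply/negP => ft0.
pose k := (Num.truncn (ev g t / ev f t)).+1.
have := fg k; rewrite -(@scaler_nat R) => /PG_leP /(_ t).
rewrite PG_scaleE leNgt => /negP; apply.
by rewrite -ltr_pdivrMr// truncnS_gt.
Qed.

Lemma PG_falg : falg (PG R n).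
Proof.
move=> f g h fg /PG_leP h0.
have key t : Num.min (ev h t * ev f t) (ev g t) = 0.
  have := congr1 (fun k : PG R n => ev k t) fg; rewrite PG_meetE.
  have : 0 <= ev h t by exact: h0.
  move: (ev h t) (ev f t) (ev g t) => c a b c0 ab.
  have [a0 b0] : 0 <= a /\ 0 <= b by split; rewrite -[0](ab) ge_min lexx ?orbT.
  have [ab'|ba'] := leP a b.
    have -> : a = 0 by rewrite -[RHS]ab; apply/esym/min_idPl.
    by rewrite mulr0; apply/min_idPl.
  have -> : b = 0 by rewrite -[RHS]ab; apply/esym/min_idPr/ltW.
  by apply/min_idPr; exact: mulr_ge0.
split; apply: pg_ext => t; rewrite PG_meetE PG_mulE; first exact: key.
by rewrite mulrC; exact: key.
Qed.

(** A localizer at [v] that does not vanish at [t] forces [t] to be near [v]. *)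
Lemma PG_represents (g : PG R n) : represents (@pg_proj R n) (g : pgfun R n) g.
Proof.
have [cg pg] := pgfunP g; have [N hN] := weighted_modulus cg pg.
exists N => eps e0; have [d d0 hd] := hN _ e0; exists d => // v psi [psi0 loc].
apply/PG_leP => t.
have pt0 : 0 <= ev psi t by move/PG_leP: psi0; exact.
rewrite PG_mulE PG_vabsE PG_scaleE PG_mulE PG_exprE PG_weightE.
rewrite PG_addE PG_oppE PG_scaleE PG_oneE mulr1 mulrCA.
move: pt0; rewrite le_eqVlt => /predU1P[<-|pt0]; first by rewrite !mul0r.
rewrite ler_pM2l//; apply: hd => i.
have /PG_leP /(_ t) := loc i.
rewrite PG_mulE PG_vabsE PG_scaleE PG_addE PG_oppE PG_scaleE PG_oneE mulr1.
by rewrite [X in _ <= X]mulrC ler_pM2l.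
Qed.

End PolynomialGrowthAlgebra.

(** Two calculi agree on the sublattice-algebra generated by the coordinates,
    which is dense in the polynomial growth algebra for convergence relative to
    a power of the weight; both calculi map such bounds to bounds in [X]. *)
Theorem calculus_unique (R : realType) (X : loAlgType R) (hX : archimedean X)
    (n : nat) (Psi Phi : PG R n -> X) :
  lattice_algebra_hom Psi -> lattice_algebra_hom Phi ->
  Psi 1 = 1 -> Phi 1 = 1 ->
  (forall i, Psi (pg_proj i) = Phi (pg_proj i)) -> Psi = Phi.
Proof.
move=> hPsi hPhi Psi1 Phi1 hproj.
pose Y : set (PG R n) := [set g | Psi g = Phi g].
have hY : sublattice_algebra Y.
  split; rewrite /Y/=.
  - by rewrite (lahom0 hPsi) (lahom0 hPhi).
  - by move=> f g fE gE; rewrite (lahomD hPsi) (lahomD hPhi) fE gE.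
  - by move=> a f fE; rewrite (lahomZ hPsi) (lahomZ hPhi) fE.
  - by move=> f g fE gE; rewrite (lahom_meet hPsi) (lahom_meet hPhi) fE gE.
  - by move=> f g fE gE; rewrite (lahom_join hPsi) (lahom_join hPhi) fE gE.
  - by move=> f g fE gE; rewrite (lahom_mul hPsi) (lahom_mul hPhi) fE gE.
have Y1 : Y 1 by rewrite /Y/= Psi1 Phi1.
have aPG := @PG_archimedean R n; have fPG := @PG_falg R n.
apply/funext => g; have [cg pg] := pgfunP g.
have [N0 happ] := interpolation_approximates aPG fPG hY Y1 hproj cg pg.
have [N NN0 hrep] := represents_weaken fPG N0 (PG_represents g).
pose W : PG R n := weight (@pg_proj R n).
have YW : Psi (W ^+ N) = Phi (W ^+ N).
  rewrite (lahom_expr hPsi)// (lahom_expr hPhi)//; congr (_ ^+ N).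
  apply: (sublatD hY) => //; apply: (sublat_sum hY) => i.
  exact: (sublat_vabs hY).
apply: (archimedean_eq hX (z := (Psi (W ^+ N) + Psi (W ^+ N)) +
  (Psi (W ^+ N) + Psi (W ^+ N)))) => eps e0.
have [y [Yy _ gy]] := happ _ e0.
have gy' := approximates_weaken fPG (ltW e0) NN0 gy.
have := approximates_dist aPG fPG (ltW e0) (ltW e0) gy' (hrep _ e0).
rewrite -/W => yg.
have yPsi := lahom_le hPsi yg; have yPhi := lahom_le hPhi yg.
rewrite (lahom_vabs hPsi) (lahomB hPsi) (lahomZ hPsi) in yPsi.
rewrite (lahom_vabs hPhi) (lahomB hPhi) (lahomZ hPhi) -YW in yPhi.
apply: (le_trans (vabs_dist _ (Psi y) _)).
rewrite scalerDr scalerDr -scalerDl; apply: lo_leD; first by rewrite vabs_subC.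
by rewrite Yy.
Qed.

(** * The range of a calculus *)

Lemma exprn_half_lt (R : realType) (eps : R) : 0 < eps ->
  exists j, 2^-1 ^+ j < eps.
Proof.
move=> e0; exists (Num.truncn eps^-1).+1.
rewrite exprVn -[eps in _ < eps]invrK ltf_pV2 ?posrE ?exprn_gt0 ?invr_gt0//.
apply: (lt_le_trans (truncnS_gt _)); rewrite -natrX ler_nat ltnW//.
exact: ltn_expl.
Qed.

Section UnitNorm.
Context {R : realType} {X : loAlgType R}.
Implicit Types (e x y b : X) (c : R).

Lemma unit_norm_le e x c : 0 <= c -> vabs x <= c *: e -> unit_norm e x <= c.
Proof. by move=> c0 xc; apply: ge_inf; [exists 0 => l []|split]. Qed.

Lemma vabs_le_unit_norm e x c : 0 <= e -> order_ideal e x ->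
  unit_norm e x < c -> vabs x <= c *: e.
Proof.
move=> e0 [l l0 xl] /inf_lt; case; first by exists l; split.
move=> l' [l'0 xl'] l'c; apply: (le_trans xl'); apply: lo_ler_wpZr => //.
exact: ltW.
Qed.

Lemma order_idealB e x y : order_ideal e x -> order_ideal e y ->
  order_ideal e (x - y).
Proof.
move=> [a a0 xa] [b b0 yb]; exists (a + b); first exact: addr_ge0.
by apply: (le_trans (vabsB _ _)); rewrite scalerDl; exact: lo_leD.
Qed.

Lemma order_ideal_bound e x c : 0 <= c -> vabs x <= c *: e -> order_ideal e x.
Proof. by move=> c0 xc; exists c. Qed.

Definition truncate b x : X := Order.join (Order.meet x b) (- b).

Lemma truncate_id b x : vabs x <= b -> truncate b x = x.
Proof.
rewrite vabs_le => /andP[xb bx].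
by rewrite /truncate (meet_idPl xb); apply/join_idPl; rewrite -lo_leN2 opprK.
Qed.

Lemma vabs_truncate b x : 0 <= b -> vabs (truncate b x) <= b.
Proof.
move=> b0; rewrite vabs_le; apply/andP; split.
  by rewrite leUx leIr/= -lo_subr_ge0 opprK lo_addr_ge0.
by rewrite -[b in _ <= b]opprK lo_leN2 leUr.
Qed.

End UnitNorm.

Section Range.
Context {R : realType} {n : nat} {X : loAlgType R} (Psi : PG R n -> X).
Hypothesis hom : lattice_algebra_hom Psi.

Local Notation ev f t := ((f : pgfun R n) t).

(** Two elements of the range with meet zero are images of disjoint functions:
    subtract from the lifts their meet, whose image is zero. *)
Lemma range_f_subalgebra : f_subalgebra (range Psi).
Proof.
split.
  split.
  - by exists 0 => //; exact: lahom0.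
  - by move=> _ _ [f _ <-] [g _ <-]; exists (f + g) => //; exact: lahomD.
  - by move=> a _ [f _ <-]; exists (a *: f) => //; exact: lahomZ.
  - move=> _ _ [f _ <-] [g _ <-]; exists (Order.meet f g) => //.
    exact: (lahom_meet hom).
  - move=> _ _ [f _ <-] [g _ <-]; exists (Order.join f g) => //.
    exact: (lahom_join hom).
  - move=> _ _ [f _ <-] [g _ <-]; exists (f * g) => //.
    exact: (lahom_mul hom).
move=> _ _ _ [f _ <-] [g _ <-] [h _ <-] fg h0.
pose m := Order.meet f g.
have m0 : Psi m = 0 by rewrite (lahom_meet hom).
have -> : Psi f = Psi (f - m) by rewrite (lahomB hom) m0 subr0.
have -> : Psi g = Psi (g - m) by rewrite (lahomB hom) m0 subr0.
have -> : Psi h = Psi (pos_part h).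
  by rewrite (lahom_join hom) (lahom0 hom) -[LHS](pos_part_id h0).
have dis : Order.meet (f - m) (g - m) = 0 by rewrite -lo_meetD subrr.
have [d1 d2] := PG_falg dis (pos_part_ge0 h).
by rewrite -!(lahom_mul hom) -!(lahom_meet hom) d1 d2 (lahom0 hom).
Qed.

(** A rapidly Cauchy sequence of functions has a limit in the algebra: the
    functions [G j - c j *: w] increase and the functions [G j + c j *: w]
    decrease, where [c j] is the tail of the geometric series. *)
Lemma PG_rapid_limit (w : PG R n) (G : nat -> PG R n) : 0 <= w ->
  (forall j, vabs (G j.+1 - G j) <= 2^-1 ^+ j *: w) ->
  exists L : PG R n, forall j, vabs (L - G j) <= (2 * 2^-1 ^+ j) *: w.
Proof.
move=> /PG_leP wpos hG; have w0 t : 0 <= ev w t by exact: wpos.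
pose c j : R := 2 * 2^-1 ^+ j.
have cS j : c j = c j.+1 + 2^-1 ^+ j.
  by rewrite /c exprS mulrA divff ?mul1r// mulr_natl mulr2n.
have c0 j : 0 <= c j by rewrite mulr_ge0// exprn_ge0// invr_ge0.
pose A j t := ev (G j) t - c j * ev w t.
pose B j t := ev (G j) t + c j * ev w t.
have step j t : `|ev (G j.+1) t - ev (G j) t| <= 2^-1 ^+ j * ev w t.
  by have /PG_leP /(_ t) := hG j; rewrite PG_vabsE.
have Amono t : {homo (fun j => A j t) : i j / (i <= j)%N >-> i <= j}.
  apply/nondecreasing_seqP => j; rewrite /A.
  have := step j t; rewrite ler_norml => /andP[h1 h2].
  by rewrite (cS j) mulrDl; lra.
have Bmono t : {homo (fun j => B j t) : i j / (i <= j)%N >-> j <= i}.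
  apply/nonincreasing_seqP => j; rewrite /B.
  have := step j t; rewrite ler_norml => /andP[h1 h2].
  by rewrite (cS j) mulrDl; lra.
have AB i j t : A i t <= B j t.
  apply: (le_trans (Amono t _ _ (leq_maxl i j))).
  apply: (le_trans _ (Bmono t _ _ (leq_maxr i j))).
  rewrite /A /B lerD2l; have := mulr_ge0 (c0 (maxn i j)) (w0 t).
  by set z := c _ * _ => z0; lra.
pose L t : R := sup (range (fun j => A j t)).
have LP j t : `|L t - ev (G j) t| <= c j * ev w t.
  rewrite ler_distl; apply/andP; split.
    by apply: sup_upper_bound; [split; [exists (A 0%N t); exists 0%N|
      exists (B 0%N t) => _ [i _ <-]; exact: AB]|exists j].
  by apply: ge_sup; [exists (A 0%N t); exists 0%N|move=> _ [i _ <-]; exact: AB].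
have cL : continuous L.
  move=> t.
  apply: (iffRL (@cvgrPdist_lt _ _ _ _ (nbhs_filter t) L (L t))) => eps e0.
  have wt0 : 0 < ev w t + 1 by rewrite ltr_wpDl.
  have [j hj] : exists j, c j * (ev w t + 1) < eps / 4.
    have [j hj] := exprn_half_lt (divr_gt0 e0 (mulr_gt0 (ltr0n _ 8) wt0)).
    exists j; rewrite /c -ltr_pdivlMr// mulrC -ltr_pdivlMr//.
    rewrite (lt_le_trans hj)// le_eqVlt; apply/orP; left; apply/eqP.
    by field; rewrite gt_eqF.
  have [cG _] := pgfunP (G j); have [cw _] := pgfunP w.
  have /cvgrPdist_lt /(_ (eps / 4) (divr_gt0 e0 (ltr0n _ 4))) nG := cG t.
  have /cvgrPdist_lt /(_ 1 ltr01) nw := cw t.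
  near=> s.
  have s1 : `|ev (G j) t - ev (G j) s| < eps / 4 by near: s.
  have s2 : `|ev w t - ev w s| < 1 by near: s.
  have s3 : c j * ev w s <= c j * (ev w t + 1).
    by apply: ler_wpM2l => //; move: s2; rewrite ltr_norml => /andP[]; lra.
  have s4 : c j * ev w t <= c j * (ev w t + 1).
    by apply: ler_wpM2l => //; rewrite lerDl.
  have l1 := LP j t; have l2 := LP j s.
  move: s1 s3 s4 l1 l2 hj.
  move: (c j * _) (c j * _) (c j * _) => p q r.
  move: (L t) (L s) (ev _ _) (ev _ _) => a b a' b'.
  rewrite !ltr_norml !ler_norml => /andP[? ?] ? ? /andP[? ?] /andP[? ?] ?.
  by apply/andP; split; lra.
have gL : polynomial_growth L.
  have [_ g0] := pgfunP (G 0%N); have [_ gw] := pgfunP (2 *: w).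
  apply: (polynomial_growth_bound g0 gw) => t.
  have := LP 0%N t; rewrite /c expr0 mulr1 PG_scaleE.
  rewrite (ger0_norm (mulr_ge0 _ (w0 t)))// => h.
  rewrite -[X in `|X|](subrK (ev (G 0%N) t)) addrC.
  by apply: (le_trans (ler_normD _ _)); rewrite lerD2l.
have Lpg : (L : 'rV[R]_n -> R^o) \in pg_pred R n by apply/asboolP.
exists (PGFun Lpg) => j; apply/PG_leP => t.
by rewrite PG_vabsE PG_scaleE PG_addE PG_oppE; exact: LP.
Unshelve. all: by end_near.
Qed.

(** A Cauchy sequence in the range is lifted along a rapidly Cauchy
    subsequence; truncating the successive differences of arbitrary lifts keeps
    them as small as their images. *)
Lemma range_complete (w : PG R n) : 0 <= w ->
  unit_norm_complete (Psi w) (range Psi `&` order_ideal (Psi w)).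
Proof.
move=> w0 u uY uC; set e := Psi w.
have e0 : 0 <= e by exact: lahom_ge0.
have cau (eps : R) : 0 < eps -> exists K : nat, forall p q : nat,
    (K <= p)%N -> (K <= q)%N -> vabs (u p - u q) <= eps *: e.
  move=> eps0; have [K hK] := uC _ eps0; exists K => p q Kp Kq.
  apply: vabs_le_unit_norm => //; last exact: hK.
  by apply: order_idealB; [exact: (uY p).2|exact: (uY q).2].
have half0 j : 0 < 2^-1 ^+ j :> R by rewrite exprn_gt0.
have /choice[K hK] (j : nat) := cau _ (half0 j).
pose k j := (\sum_(i < j.+1) K i)%N.
have Kk j : (K j <= k j)%N by rewrite /k big_ord_recr/= leq_addl.
have kS j : (K j <= k j.+1)%N.
  by rewrite (leq_trans (Kk j))// /k [in leqRHS]big_ord_recr/= leq_addr.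
pose a j := u (k j).
have da j : vabs (a j.+1 - a j) <= 2^-1 ^+ j *: e by exact: hK.
have /choice[H hH] (j : nat) : exists h : PG R n, Psi h = a j.
  by have [[h _ hE] _] := uY (k j); exists h.
pose G := fix G j := if j is i.+1
  then G i + truncate (2^-1 ^+ i *: w) (H j - G i) else H 0%N.
have GS j : G j.+1 = G j + truncate (2^-1 ^+ j *: w) (H j.+1 - G j) by [].
have wj j : 0 <= 2^-1 ^+ j *: w by rewrite lo_scaler_ge0// ltW.
have PG_ j : Psi (G j) = a j.
  elim: j => [|j IH]; first exact: hH.
  rewrite GS (lahomD hom) IH (lahom_join hom) (lahom_meet hom) (lahomN hom).
  rewrite (lahomZ hom) (lahomB hom) hH IH -/(truncate _ _) truncate_id//.
  by rewrite addrC subrK.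
have [|L hL] := @PG_rapid_limit w G w0.
  by move=> j; rewrite GS addrAC subrr add0r vabs_truncate.
have La j : vabs (a j - Psi L) <= (2 * 2^-1 ^+ j) *: e.
  by have := lahom_le hom (hL j); rewrite (lahom_vabs hom) (lahomB hom)
    (lahomZ hom) PG_ vabs_subC.
exists (Psi L).
  split; first by exists L.
  rewrite -[Psi L](subKr (a 0%N)); apply: order_idealB; first exact: (uY _).2.
  by apply: order_ideal_bound (La 0%N); rewrite mulr_ge0// ltW.
move=> eps eps0.
have [j hj] : exists j, 2^-1 ^+ j + 2 * 2^-1 ^+ j < eps :> R.
  have [j hj] := exprn_half_lt (divr_gt0 eps0 (ltr0n R 3)).
  by exists j; move: hj; rewrite ltr_pdivlMr//; lra.
exists (K j) => p Kp; apply: le_lt_trans hj; apply: unit_norm_le.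
  by rewrite addr_ge0 ?mulr_ge0// ltW.
apply: (le_trans (vabs_dist _ (a j) _)); rewrite scalerDl; apply: lo_leD => //.
by apply: hK => //; exact: Kk.
Qed.

End Range.

(** * Subalgebras as lattice-ordered algebras *)

Section SubAlgebra.
Context {R : realType} {X : loAlgType R} {Y : set X}.

Definition subalg_pred : {pred X} := fun x => `[< Y x >].

(** The closure proofs are parameters of the type because the instances on it
    depend on them. *)
Record subalg (hY : sublattice_algebra Y) (Y1 : Y 1) := SubAlg {
  subalg_val :> X;
  subalg_valP : subalg_val \in subalg_pred
}.

Variables (hY : sublattice_algebra Y) (Y1 : Y 1).
Local Notation Z := (subalg hY Y1).

HB.instance Definition _ := [isSub for @subalg_val hY Y1].
HB.instance Definition _ := [Choice of Z by <:].

Lemma subalg_zmod_closed : zmod_closed subalg_pred.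
Proof.
split; first by apply/asboolP; exact: sublat0.
by move=> x y /asboolP Yx /asboolP Yy; apply/asboolP; exact: sublatB.
Qed.

HB.instance Definition _ :=
  GRing.SubChoice_isSubZmodule.Build _ _ Z subalg_zmod_closed.

Lemma subalg_subsemimod_closed : subsemimod_closed subalg_pred.
Proof.
split; first exact: GRing.zmod_closedD subalg_zmod_closed.
by move=> a x /asboolP Yx; apply/asboolP; exact: sublatZ.
Qed.

HB.instance Definition _ :=
  GRing.SubZmodule_isSubLmodule.Build _ _ _ Z subalg_subsemimod_closed.

Lemma subalg_mem (z : Z) : Y z. Proof. exact/asboolP/subalg_valP. Qed.

Fact mem_subalg_pred x : Y x -> x \in subalg_pred.
Proof. by move=> Yx; apply/asboolP. Qed.

Definition mk_subalg x (Yx : Y x) : Z := SubAlg hY Y1 (mem_subalg_pred Yx).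

Definition subalg_le (x y : Z) : bool := subalg_val x <= subalg_val y.
Definition subalg_meet (x y : Z) : Z :=
  mk_subalg (sublat_meet hY (subalg_mem x) (subalg_mem y)).
Definition subalg_join (x y : Z) : Z :=
  mk_subalg (sublat_join hY (subalg_mem x) (subalg_mem y)).
Definition subalg_mul (x y : Z) : Z :=
  mk_subalg (sublatM hY (subalg_mem x) (subalg_mem y)).

Fact subalg_le_refl : reflexive subalg_le. Proof. by move=> x; exact: lexx. Qed.
Fact subalg_le_anti : antisymmetric subalg_le.
Proof. by move=> x y /le_anti xy; exact: val_inj. Qed.
Fact subalg_le_trans : transitive subalg_le.
Proof. by move=> y x z; exact: le_trans. Qed.
Fact subalg_meetP x y z :
  subalg_le x (subalg_meet y z) = subalg_le x y && subalg_le x z.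
Proof. exact: lexI. Qed.
Fact subalg_joinP x y z :
  subalg_le (subalg_join x y) z = subalg_le x z && subalg_le y z.
Proof. exact: leUx. Qed.
Fact subalg_leD2r z x y : subalg_le x y -> subalg_le (x + z) (y + z).
Proof. exact: lo_leD2. Qed.
Fact subalg_scale_ge0 (a : R) x :
  0 <= a -> subalg_le 0 x -> subalg_le 0 (a *: x).
Proof. exact: lo_scaler_ge0. Qed.
Fact subalg_mulA : associative subalg_mul.
Proof. by move=> x y z; apply: val_inj; exact: mulrA. Qed.
Fact subalg_mul1r : left_id (mk_subalg Y1) subalg_mul.
Proof. by move=> x; apply: val_inj; exact: mul1r. Qed.
Fact subalg_mulr1 : right_id (mk_subalg Y1) subalg_mul.
Proof. by move=> x; apply: val_inj; exact: mulr1. Qed.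
Fact subalg_mulDl : left_distributive subalg_mul +%R.
Proof. by move=> x y z; apply: val_inj; exact: mulrDl. Qed.
Fact subalg_mulDr : right_distributive subalg_mul +%R.
Proof. by move=> x y z; apply: val_inj; exact: mulrDr. Qed.
Fact subalg_scaleAl (a : R) x y : a *: subalg_mul x y = subalg_mul (a *: x) y.
Proof. by apply: val_inj; exact: lo_scaleAl. Qed.
Fact subalg_scaleAr (a : R) x y : a *: subalg_mul x y = subalg_mul x (a *: y).
Proof. by apply: val_inj; exact: lo_scaleAr. Qed.
Fact subalg_mul_ge0 x y :
  subalg_le 0 x -> subalg_le 0 y -> subalg_le 0 (subalg_mul x y).
Proof. exact: lo_mulr_ge0. Qed.

Definition subalg_loAlg : loAlgType R :=
  LOAlg subalg_le_refl subalg_le_anti subalg_le_trans subalg_meetP subalg_joinP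
    subalg_leD2r subalg_scale_ge0 subalg_mulA subalg_mul1r subalg_mulr1
    subalg_mulDl subalg_mulDr subalg_scaleAl subalg_scaleAr subalg_mul_ge0.

Definition subalg_incl (z : subalg_loAlg) : X := subalg_val (z : Z).

Lemma subalg_incl_hom : lattice_algebra_hom subalg_incl.
Proof. by split. Qed.

Lemma subalg_incl_inj : injective subalg_incl.
Proof. exact: val_inj. Qed.

Lemma subalg_inclE (x y : subalg_loAlg) :
  (subalg_incl x <= subalg_incl y) = (x <= y).
Proof. by []. Qed.

Lemma subalg_archimedean : archimedean X -> archimedean subalg_loAlg.
Proof.
move=> hX x y x0 xy; apply: subalg_incl_inj.
apply: (hX _ (subalg_incl y)) => // k.
by rewrite -(@scaler_nat R) -(lahomZ subalg_incl_hom) subalg_inclE scaler_nat.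
Qed.

Lemma subalg_falg : f_subalgebra Y -> falg subalg_loAlg.
Proof.
move=> [_ fY] x y z xy z0.
have [h1 h2] := fY _ _ _ (subalg_mem x) (subalg_mem y) (subalg_mem z)
  (congr1 subalg_incl xy) z0.
by split; apply: subalg_incl_inj.
Qed.

End SubAlgebra.

(** Compare [u p] with the limit through a term of the sequence far out: this
    adds a multiple of [w] with an arbitrarily small factor, which the
    Archimedean property removes. *)
Lemma sharpen_limit_bound (R : realType) (X : loAlgType R) (hX : archimedean X)
    (e w l : X) (u : nat -> X) :
  (forall eps : R, 0 < eps -> exists K : nat, forall p q : nat,
     (K <= p)%N -> (K <= q)%N -> vabs (u p - u q) <= eps *: e) ->
  (forall eps : R, 0 < eps -> exists K : nat, forall p : nat,
     (K <= p)%N -> vabs (u p - l) <= eps *: w) ->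
  forall eps : R, 0 < eps -> exists K : nat, forall p : nat,
     (K <= p)%N -> vabs (u p - l) <= eps *: e.
Proof.
move=> uC ul eps eps0; have [K hK] := uC _ eps0; exists K => p Kp.
apply: (archimedean_le hX (z := w)) => eta eta0; have [K' hK'] := ul _ eta0.
apply: (le_trans (vabs_dist _ (u (maxn K K')) _)); apply: lo_leD.
  by apply: hK => //; exact: leq_maxl.
by apply: hK'; exact: leq_maxr.
Qed.

(** The calculus is built in [Y], where the powers of the weight are at most
    multiples of the corresponding powers of [f]; the latter need not belong to
    [Y]. *)
Theorem calculus_of_complete (R : realType) (X : loAlgType R)
    (hX : archimedean X) (n : nat) (x : 'I_n -> X) (f : X) (Y : set X) :
  1 <= f :> X -> (forall i, vabs (x i) <= f) ->
  f_subalgebra Y -> Y 1 -> (forall i, Y (x i)) ->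
  (forall m, unit_norm_complete (f ^+ m.+1) (Y `&` order_ideal (f ^+ m.+1))) ->
  exists Psi : PG R n -> X, [/\ lattice_algebra_hom Psi, Psi 1 = 1
      & forall i : 'I_n, Psi (pg_proj i) = x i].
Proof.
move=> f1 xf fY Y1 Yx cY; have hY := fY.1.
pose Z : loAlgType R := subalg_loAlg hY Y1.
pose incl : Z -> X := @subalg_incl _ _ _ hY Y1.
have hom : lattice_algebra_hom incl := subalg_incl_hom hY Y1.
have hZ : archimedean Z := subalg_archimedean hX.
have fZ : falg Z := subalg_falg fY.
have p1 : 0 <= 1 :> X := lahom_le hom (falg_ge01 fZ).
have f0 : 0 <= f := le_trans p1 f1.
pose z i : Z := mk_subalg hY Y1 (Yx i).
have inclW : incl (weight z) = weight x.
  rewrite /weight (lahomD hom); congr (_ + _).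
  elim/big_rec2: _ => [|i b c _ <-]; first exact: (lahom0 hom).
  by rewrite (lahomD hom) (lahom_vabs hom).
have Wf : weight x <= n.+1%:R *: f.
  have -> : n.+1%:R *: f = f + \sum_(i < n) f.
    by rewrite sumr_const card_ord scaler_nat mulrS.
  by apply: lo_leD => //; exact: lo_le_sum.
have W0 : 0 <= weight x by exact: weight_ge0.
have WNf N : weight x ^+ N <= n.+1%:R ^+ N *: f ^+ N.
  by rewrite -lo_exprZn; exact: lo_ler_exprn.
have [|Phi [hPhi Phi1 Phix]] := calculus_exists hZ fZ (x := z); last first.
  exists (incl \o Phi); split.
  - split.
    + by move=> a g h /=; rewrite (lahom_linear hPhi) (lahom_linear hom).
    + by move=> g h /=; rewrite (lahom_meet hPhi) (lahom_meet hom).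
    + by move=> g h /=; rewrite (lahom_join hPhi) (lahom_join hom).
    + by move=> g h /=; rewrite (lahom_mul hPhi) (lahom_mul hom).
  - by rewrite /= Phi1.
  - by move=> i; rewrite /= Phix.
move=> N u uB uC; pose M := N.+1; pose F := f ^+ M.
have F0 : 0 <= F by exact: lo_exprn_ge0.
pose v k := incl (u k).
have toF (c : R) (s : Z) : 0 <= c -> vabs s <= c *: weight z ^+ M ->
    vabs (incl s) <= (c * n.+1%:R ^+ M) *: F.
  move=> c0 /(lahom_le hom).
  rewrite (lahom_vabs hom) (lahomZ hom) (lahom_expr hom)// inclW => h.
  by apply: (le_trans h); rewrite -scalerA; exact: lo_ler_wpZl.
have W0Z : 0 <= weight z ^+ M.
  apply: lo_exprn_ge0; first exact: falg_ge01.
  by apply: weight_ge0; exact: falg_ge01.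
have vY k : (Y `&` order_ideal F) (v k).
  split; first exact: subalg_mem.
  have [C hC] := uB k.
  have uk : vabs (u k) <= `|C| *: weight z ^+ M.
    by apply: (le_trans hC); apply: lo_ler_wpZr => //; exact: ler_norm.
  apply: order_ideal_bound (toF _ _ (normr_ge0 C) uk).
  by rewrite mulr_ge0// exprn_ge0.
have k0 : 0 < n.+1%:R ^+ M :> R by rewrite exprn_gt0// ltr0n.
have [|l [Yl Fl] hl] := cY N v vY.
  move=> eps eps0.
  have eps1 := divr_gt0 (divr_gt0 eps0 (ltr0n _ 2)) k0.
  have [K hK] := uC _ eps1; exists K => p q Kp Kq.
  apply: (@le_lt_trans _ _ (eps / 2)); last first.
    by rewrite ltr_pdivrMr// ltr_pMr// ltr1n.
  apply: unit_norm_le; first by rewrite divr_ge0// ltW.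
  have := toF _ _ _ (hK p q Kp Kq); rewrite divfK ?gt_eqF// (lahomB hom); apply.
  by rewrite !divr_ge0// ltW.
have vl (eps : R) : 0 < eps -> exists K : nat, forall p : nat,
    (K <= p)%N -> vabs (v p - l) <= eps *: F.
  move=> eps0; have [K hK] := hl _ eps0; exists K => p Kp.
  apply: vabs_le_unit_norm => //; last exact: hK.
  by apply: order_idealB => //; exact: (vY p).2.
pose L : Z := mk_subalg hY Y1 Yl; exists L => eps eps0.
have [|K hK] := sharpen_limit_bound hX (e := weight x ^+ M) _ vl eps0.
  move=> eta eta0; have [K hK] := uC _ eta0; exists K => p q Kp Kq.
  have := lahom_le hom (hK p q Kp Kq).
  rewrite (lahom_vabs hom) (lahomZ hom) (lahom_expr hom)// inclW.
  by rewrite (lahomB hom).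
exists K => p Kp; have := hK p Kp.
by rewrite -inclW -(lahom_expr hom).
Qed.

(** * The equivalence *)

Theorem theorem3p1 (R : realType) (X : loAlgType R) (hX : archimedean X)
    (n : nat) (hn : (0 < n)%N) (x : 'I_n -> X) :
  let e : X := \big[Order.join/1]_(i < n) vabs (x i) in
  let calculus (Psi : PG R n -> X) : Prop :=
    [/\ lattice_algebra_hom Psi, Psi 1 = 1
      & forall i : 'I_n, Psi (pg_proj i) = x i] in
  let cond_i : Prop := exists Psi : PG R n -> X, calculus Psi in
  let cond_ii : Prop := exists Y : set X,
    [/\ f_subalgebra Y, Y 1, (forall i : 'I_n, Y (x i))
      & forall m : nat, (0 < m)%N ->
          unit_norm_complete (e ^+ m) (Y `&` order_ideal (e ^+ m))] in
  let cond_iii : Prop := exists f : X, e <= f /\ exists Y : set X,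
    [/\ f_subalgebra Y, Y 1, (forall i : 'I_n, Y (x i))
      & forall m : nat, (0 < m)%N ->
          unit_norm_complete (f ^+ m) (Y `&` order_ideal (f ^+ m))] in
  [/\ cond_i <-> cond_ii, cond_ii <-> cond_iii
    & forall Psi Phi : PG R n -> X, calculus Psi -> calculus Phi -> Psi = Phi].
Proof.
move=> e calculus cond_i cond_ii cond_iii.
have e1 : 1 <= e :> X.
  by rewrite /e; elim/big_rec: _ => // i y _ /le_trans; apply; exact: leUr.
have xe i : vabs (x i) <= e.
  by rewrite /e (bigD1_seq i) ?mem_index_enum ?index_enum_uniq//= leUl.
have i_ii : cond_i -> cond_ii.
  move=> [Psi [hom Psi1 Psix]]; exists (range Psi).
  have Psie : Psi (\big[Order.join/1]_(i < n) vabs (pg_proj i)) = e.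
    rewrite /e; elim/big_rec2: _ => [//|i y z _ <-].
    by rewrite (lahom_join hom) (lahom_vabs hom) Psix.
  split.
  - exact: range_f_subalgebra.
  - by exists 1.
  - by move=> i; exists (pg_proj i).
  - move=> m _; rewrite -Psie -(lahom_expr hom)//; apply: range_complete => //.
    have p1 := falg_ge01 (@PG_falg R n).
    apply: lo_exprn_ge0 => //; apply: (le_trans p1).
    by elim/big_rec: _ => // i y _ /le_trans; apply; exact: leUr.
have ii_iii : cond_ii -> cond_iii.
  by move=> [Y hY]; exists e; split => //; exists Y.
have iii_i : cond_iii -> cond_i.
  move=> [f [ef [Y [fY Y1 Yx cY]]]].
  apply: (calculus_of_complete hX (f := f) (Y := Y)) => //.
  - exact: le_trans ef.
  - by move=> i; exact: le_trans ef.
  - by move=> m; exact: cY.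
split; [split|split|] => //.
- by move=> /ii_iii.
- by move=> /iii_i.
- move=> Psi Phi [hPsi Psi1 Psix] [hPhi Phi1 Phix].
  by apply: calculus_unique => // i; rewrite Psix Phix.
Qed.
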